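(* Let $m\ge 3$ be an integer, let $d_m:=m(m+1)/2-1$, let $E_1,\dots,E_{d_m}$ be a fixed orthonormal basis of $\mathrm{Sym}_0(m)$ (with respect to the Frobenius inner product), and let $w_m:\mathbb{R}^{d_m}\to\mathbb{R}$ be defined by $w_m(x):=W_m\big(\sum_{i=1}^{d_m}x_iE_i\big)$, where $W_m(X):=\mathrm{tr}(X^3)/\|X\|_F$ for $X\in \mathrm{Sym}_0(m)\setminus\{0\}$ and $W_m(0):=0$. Then there exists $F_m:\mathrm{Sym}(d_m)\to\mathbb{R}$ satisfying $$\lambda\,\mathrm{tr}\,N\le F_m(M+N)-F_m(M)\le \Lambda\,\mathrm{tr}\,N\quad\text{for all } M,N\in \mathrm{Sym}(d_m)\text{ with } N\ge 0,$$ with $\lambda=1$ and $\Lambda=1+(m+3)(d_m+3)$, such that $w_m$ is a viscosity solution of $F_m(D^2w_m)=0$ in $\mathbb{R}^{d_m}$. Moreover, $w_m$ belongs to $C^{1,1}(\mathbb{R}^{d_m})$, is homogeneous of degree two, and is real analytic in $\mathbb{R}^{d_m}\setminus\{0\}$, but is not twice differentiable at $0$.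
   Context: $\mathrm{Sym}(n)$ is the space of real symmetric $n\times n$ matrices; $N\ge0$ means positive semidefinite. $\mathrm{Sym}_0(m)$ is the space of traceless real symmetric $m\times m$ matrices, with Frobenius inner product $\langle X,Y\rangle:=\mathrm{tr}(XY)$ and norm $\|X\|_F:=\sqrt{\mathrm{tr}(X^2)}$; its dimension is $d_m$. Viscosity solution of $F(D^2u)=0$ in an open set $\Omega$: $u$ is continuous, and for every $x_0\in\Omega$ and every $C^2$ function $\varphi$ near $x_0$, if $\varphi$ touches $u$ from above at $x_0$ (i.e. $\varphi(x_0)=u(x_0)$ and $\varphi\ge u$ near $x_0$) then $F(D^2\varphi(x_0))\ge 0$, and if $\varphi$ touches $u$ from below at $x_0$ then $F(D^2\varphi(x_0))\le0$. $C^{1,1}$ means continuously differentiable with Lipschitz gradient. *)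

(* Defs.v *)
From HB Require Import structures.
From mathcomp Require Import all_boot all_order all_algebra.
From mathcomp Require Import all_classical all_reals all_analysis.
From mathcomp Require summability.

Set Implicit Arguments.
Unset Strict Implicit.
Unset Printing Implicit Defensive.

Import Order.TTheory GRing.Theory Num.Theory.
Import numFieldNormedType.Exports.

Local Open Scope classical_set_scope.
Local Open Scope ring_scope.

(** R^n is ['rV[R]_n]. The library norm on it is the sup norm; it only enters
    below through notions (differentiability, limits, Lipschitz with some
    constant, existence of a ball of convergence) that do not depend on the
    choice of a norm on R^n. *)

Section Calculus.
Context {R : realType} {n : nat}.
Implicit Types (f u phi : 'rV[R]_n -> R) (x h : 'rV[R]_n) (U : set 'rV[R]_n).

Definition partial (i : 'I_n) f x : R := 'D_(delta_mx 0 i) f x.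

Definition gradient f x : 'rV[R]_n := \row_i partial i f x.

Definition hessian f x : 'M[R]_n := \matrix_(i, j) partial j (partial i f) x.

(** Meaningful for [U] open. *)
Definition C1_on U f :=
  forall x, U x -> differentiable f x /\ {for x, continuous (gradient f)}.

Definition C2_on U f := C1_on U f /\ forall i, C1_on U (partial i f).

Definition C2_near x f := exists2 U, open_nbhs x U & C2_on U f.

Definition C11 f := C1_on setT f /\ lipschitz (gradient f).

Definition twice_differentiable_at x f :=
  (\forall y \near x, differentiable f y) /\ differentiable (gradient f) x.

(** [f (t x) = t^k f x] for [t > 0] only: with [W] below, [W (- X) = - W X]. *)
Definition positively_homogeneous (k : nat) f :=
  forall (t : R) x, 0 < t -> f (t *: x) = t ^+ k * f x.

Definition monomial (a : {ffun 'I_n -> nat}) h : R :=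
  \prod_(i < n) h 0 i ^+ a i.

(** The sum over multi-indices is unordered: [totally] is the filter of finite
    sets of multi-indices directed by inclusion, so convergence along it is
    absolute convergence. *)
Definition real_analytic_on U f :=
  forall x, U x ->
  exists c : {ffun 'I_n -> nat} -> R, exists2 r : R, 0 < r &
  forall h, `|h| < r ->
    summability.partial_sum (fun a => c a * monomial a h)
      @ @summability.totally _ --> f (x + h).

Definition psd (N : 'M[R]_n) := forall x, 0 <= (x *m N *m x^T) 0 0.

(** A function on symmetric matrices is represented by a function on all square
    matrices, of which only the values at symmetric matrices matter. *)
Definition uniformly_elliptic (lambda Lambda : R) (F : 'M[R]_n -> R) :=
  forall M N : 'M[R]_n,
    M \is symmetricmx -> N \is symmetricmx -> psd N ->
    lambda * \tr N <= F (M + N) - F M <= Lambda * \tr N.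

Definition touches_from_above phi u x :=
  phi x = u x /\ \forall y \near x, u y <= phi y.

Definition touches_from_below phi u x :=
  phi x = u x /\ \forall y \near x, phi y <= u y.

Definition viscosity_solution (F : 'M[R]_n -> R) U u :=
  {within U, continuous u} /\
  forall x phi, U x -> C2_near x phi ->
    (touches_from_above phi u x -> 0 <= F (hessian phi x)) /\
    (touches_from_below phi u x -> F (hessian phi x) <= 0).

End Calculus.

Section TracelessSymmetric.
Context {R : realType} {m : nat}.
Implicit Types X Y : 'M[R]_m.

Definition Sym0 : set 'M[R]_m := [set X | X \is symmetricmx /\ \tr X = 0].

Definition frob_dot X Y : R := \tr (X *m Y).

Definition frob_norm X : R := Num.sqrt (\tr (X ^+ 2)).

Definition W X : R := if X == 0 then 0 else \tr (X ^+ 3) / frob_norm X.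

Definition from_coords d (E : 'I_d -> 'M[R]_m) (x : 'rV[R]_d) : 'M[R]_m :=
  \sum_(i < d) x 0 i *: E i.

Definition orthonormal_basis_Sym0 d (E : 'I_d -> 'M[R]_m) :=
  [/\ forall i, Sym0 (E i),
      forall i j, frob_dot (E i) (E j) = (i == j)%:R &
      forall X, Sym0 X -> exists x, X = from_coords E x].

Definition w d (E : 'I_d -> 'M[R]_m) (x : 'rV[R]_d) : R := W (from_coords E x).

End TracelessSymmetric.

Definition dimSym0 (m : nat) : nat := ((m * m.+1) %/ 2 - 1)%N.

(* Main.v *)
Require Import Defs.
From mathcomp Require Import all_boot all_order all_algebra finmap.
From mathcomp Require Import all_classical all_reals all_analysis.
From mathcomp Require summability.
From mathcomp Require Import ring lra.

Set Implicit Arguments.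
Unset Strict Implicit.
Unset Printing Implicit Defensive.

Import Order.TTheory GRing.Theory Num.Theory.
Import numFieldNormedType.Exports.
Local Open Scope classical_set_scope.
Local Open Scope ring_scope.

(** Write [A] for the unit matrix [X / |X|] of a nonzero traceless symmetric
    [X]. Differentiating [tr(X^3) / |X|] twice shows that the Hessian of [w]
    at [X] is the quadratic form [hessW A] ([bil_hessian_w]); it depends on
    [A] only, and its trace is [- (d + 3) tr(A^3)] with [d = dimSym0 m]
    ([mxtrace_hessian_w]).

    The operator is an envelope. Let [G(M) = tr M + K sup_(|v| <= 1) v M v^T]
    with [K = (m + 3) (d + 3)] ([extremal]), and let [F(M)] be the infimum of
    [G(M - D^2 w(x))] over [x != 0] ([envelope]). As [G] is uniformly elliptic
    with constants [1] and [1 + K], so is [F]. As [G] is also subadditive, [F] is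
    finite and vanishes on all Hessians of [w], provided that [G] is nonnegative
    on the difference of any two of them ([extremal_hessian_w_ge0]). Let [B], [A] be
    unit matrices with [delta = tr(A^3) - tr(B^3)]. The trace of
    [hessW A - hessW B] is [- (d + 3) delta]; when it is negative, it has to
    be compensated by one direction in which this difference is large. That is
    [hess_gap], the heart of the proof: some [V] satisfies
    [hessW A V - hessW B V > delta / (m + 3) |V|^2].

    [hess_gap] is proved by contradiction. Put [S = A + B], [C = A - B] and
    [eta = 1 / (m + 3)]; then [delta = 3/4 tr(C S^2) + 1/4 tr(C^3)]. Let [e]
    be a unit eigenvector of [C] for its largest eigenvalue [lam]. Testing
    with matrices [V] supported on the plane of [e] and another vector [f]
    bounds [lam + f C f^T] by [(1 + eta) delta / 3] ([eigen_sum_le_of_lt1],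
    [eigen_sum_le]). So [C] is small, or negative, in the directions
    orthogonal to [e], and positivity of [tr(Z N Z^T)] for well chosen
    positive semidefinite [N] then bounds [tr(C S^2)] so well that [delta]
    would be smaller than itself. The two cases are [not_npos_off_top], in
    which [C] is nonpositive off [e], and [second_eigenvalue_npos].

    Away from the origin [w] is smooth, so the viscosity inequalities follow
    from the comparison of Hessians at a contact point and from the
    monotonicity of [F]. Suppose that [phi] touches [w] at [0], say from above,
    and let [M] be its Hessian there. By homogeneity [1/2 v M v^T >= w(v)] for
    all [v]. Lower [M] by a multiple of the identity until equality holds at
    some unit vector [b]: then the lowered matrix dominates [D^2 w(b)], hence
    so does [M], and [F(M) >= F(D^2 w(b)) = 0] ([quadratic_contact_origin]).

    The regularity of [w] comes from its form, a sum of products of linear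
    functions and of the inverse norm, homogeneous of degree two. Such
    expressions are closed under differentiation, which lowers the degree by
    one; so the second derivatives are bounded and the gradient is Lipschitz
    ([C11_rhom2]). If the gradient were differentiable at [0], being
    homogeneous of degree one it would be linear, and Euler's identity would
    make [w] even; but [w] is odd and not zero
    ([not_twice_differentiable_rhom2]). Finally [w(x + h)] is a cubic
    polynomial in [h] times [1 / |x + h|], and Newton's iteration approximates
    [1 / |x + h|] by polynomials in [h] whose coefficients converge
    geometrically fast ([analytic_inv_free]). *)

(** * Quadratic forms and traces of symmetric matrices *)

Section Bilinear.
Context {R : comPzRingType} {n : nat}.
Implicit Types (X Y : 'M[R]_n) (u v : 'rV[R]_n).

Definition bil X u v : R := (u *m X *m v^T) 0 0.
Definition dotv u v : R := (u *m v^T) 0 0.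

Lemma dotvE u v : dotv u v = \sum_i u 0 i * v 0 i.
Proof. by rewrite /dotv mxE; apply: eq_bigr => i _; rewrite mxE. Qed.

Lemma dotvC u v : dotv u v = dotv v u.
Proof. by rewrite !dotvE; apply: eq_bigr => i _; rewrite mulrC. Qed.

Lemma dotvDl u1 u2 v : dotv (u1 + u2) v = dotv u1 v + dotv u2 v.
Proof. by rewrite /dotv mulmxDl mxE. Qed.

Lemma dotvZl c u v : dotv (c *: u) v = c * dotv u v.
Proof. by rewrite /dotv -scalemxAl mxE. Qed.

Lemma dotvNl u v : dotv (- u) v = - dotv u v.
Proof. by rewrite /dotv mulNmx mxE. Qed.

Lemma dotvDr u v1 v2 : dotv u (v1 + v2) = dotv u v1 + dotv u v2.
Proof. by rewrite dotvC dotvDl !(dotvC u). Qed.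

Lemma dotvZr c u v : dotv u (c *: v) = c * dotv u v.
Proof. by rewrite dotvC dotvZl (dotvC u). Qed.

Lemma dotvNr u v : dotv u (- v) = - dotv u v.
Proof. by rewrite dotvC dotvNl (dotvC u). Qed.

Lemma dotv_delta i v : dotv (delta_mx 0 i) v = v 0 i.
Proof.
rewrite dotvE (bigD1 i) //= big1 ?addr0 ?mxE ?eqxx ?mul1r // => j ji.
by rewrite mxE eqxx (negbTE ji) mul0r.
Qed.

Lemma bil_dotv X u v : bil X u v = dotv (u *m X) v.
Proof. by []. Qed.

Lemma bilC X u v : X^T = X -> bil X u v = bil X v u.
Proof.
move=> sX; rewrite /bil -[LHS](@trace_mx11 _ (u *m X *m v^T)) -mxtrace_tr.
by rewrite !trmx_mul trmxK sX mulmxA trace_mx11.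
Qed.

Lemma bilM X Y u v : Y^T = Y ->
  bil (X *m Y) u v = dotv (u *m X) (v *m Y).
Proof. by move=> sY; rewrite /bil /dotv trmx_mul sY !mulmxA. Qed.

Lemma mxtrace_outer X u v : \tr (X *m (u^T *m v)) = bil X v u.
Proof. by rewrite mulmxA mxtrace_mulC mulmxA trace_mx11. Qed.

Lemma outer_mul (a b c d : 'rV[R]_n) :
  (a^T *m b) *m (c^T *m d) = dotv b c *: (a^T *m d).
Proof.
by rewrite mulmxA -(mulmxA a^T) (mx11_scalar (b *m c^T)) mul_mx_scalar scalemxAl.
Qed.

Lemma bilDM X Y u v : bil (X + Y) u v = bil X u v + bil Y u v.
Proof. by rewrite !bil_dotv mulmxDr dotvDl. Qed.

Lemma bilNM X u v : bil (- X) u v = - bil X u v.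
Proof. by rewrite !bil_dotv mulmxN dotvNl. Qed.

Lemma bilZM a X u v : bil (a *: X) u v = a * bil X u v.
Proof. by rewrite !bil_dotv -scalemxAr dotvZl. Qed.

Lemma bil1M u v : bil 1%:M u v = dotv u v.
Proof. by rewrite bil_dotv mulmx1. Qed.

Lemma bil_outer (a b : 'rV[R]_n) u v : bil (a^T *m b) u v = dotv u a * dotv b v.
Proof.
by rewrite bil_dotv mulmxA (mx11_scalar (u *m a^T)) mul_scalar_mx dotvZl.
Qed.

Lemma bil_subZ X u v t :
  bil X (u - t *: v) (u - t *: v)
    = bil X u u - t * bil X u v - t * bil X v u + t ^+ 2 * bil X v v.
Proof.
rewrite !bil_dotv mulmxBl -scalemxAl.
by rewrite !(dotvDl, dotvNl, dotvDr, dotvNr, dotvZr, dotvZl); ring.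
Qed.

End Bilinear.

Section Plane.
Context {R : comPzRingType} {n : nat}.
Implicit Types (X A : 'M[R]_n) (e f : 'rV[R]_n).

(** The Hessian of [tr(X^3) / |X|] at a unit matrix [A], as a quadratic form
    in the direction [V]; see [bil_hessian_w]. *)
Definition hessW A (V : 'M[R]_n) : R :=
  6 * \tr (A *m (V *m V)) - 6 * \tr (A *m A *m V) * \tr (A *m V)
  + 3 * \tr (A *m A *m A) * \tr (A *m V) ^+ 2
  - \tr (A *m A *m A) * \tr (V *m V).

(** For orthonormal [e] and [f] these are the traceless symmetric matrices
    supported on the plane of [e] and [f]. They are convenient test directions
    because their squares are scalar on that plane. *)
Definition plane_mx e f (al be : R) : 'M[R]_n :=
  e^T *m (al *: e + be *: f) + f^T *m (be *: e - al *: f).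

Lemma plane_mx_sym e f al be : (plane_mx e f al be)^T = plane_mx e f al be.
Proof.
by apply/matrixP => i j; rewrite !mxE !big_ord1 !mxE; ring.
Qed.

Lemma mxtrace_mul_plane_mx X e f al be : X^T = X ->
  \tr (X *m plane_mx e f al be) = al * (bil X e e - bil X f f) + 2 * be * bil X e f.
Proof.
move=> sX; rewrite /plane_mx mulmxDr mxtraceD !mxtrace_outer.
rewrite !bil_dotv !mulmxDl mulNmx -!scalemxAl !(dotvDl, dotvNl, dotvZl).
by rewrite -!bil_dotv (bilC f e sX); ring.
Qed.

Lemma plane_mx_sqr e f al be : dotv e e = 1 -> dotv f f = 1 -> dotv e f = 0 ->
  plane_mx e f al be *m plane_mx e f al be
    = (al ^+ 2 + be ^+ 2) *: (e^T *m e + f^T *m f).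
Proof.
move=> ee ff ef; have fe : dotv f e = 0 by rewrite dotvC.
rewrite /plane_mx; set a := _ + be *: f; set b := _ - al *: f.
rewrite mulmxDl !(mulmxDr (_ *m _)) !outer_mul {}/a {}/b.
rewrite !(dotvDl, dotvNl, dotvZl) ee ff ef fe.
by apply/matrixP => i j; rewrite !mxE !big_ord1 !mxE; ring.
Qed.

Lemma mxtrace_plane_mx e f al be : dotv e e = 1 -> dotv f f = 1 -> dotv e f = 0 ->
  \tr (plane_mx e f al be) = 0.
Proof.
move=> ee ff ef; rewrite -[plane_mx _ _ _ _]mul1mx mxtrace_mul_plane_mx ?trmx1 //.
by rewrite !bil_dotv !mulmx1 ee ff ef; ring.
Qed.

Lemma hessW_plane_mx A e f al be : A^T = A ->
  dotv e e = 1 -> dotv f f = 1 -> dotv e f = 0 ->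
  let p := \tr (A *m A *m A) in
  let n := al ^+ 2 + be ^+ 2 in
  let x := al * (bil A e e - bil A f f) + 2 * be * bil A e f in
  hessW A (plane_mx e f al be) =
    6 * (n * (bil A e e + bil A f f))
    - 6 * (al * (dotv (e *m A) (e *m A) - dotv (f *m A) (f *m A))
           + 2 * be * dotv (e *m A) (f *m A)) * x
    + 3 * p * x ^+ 2 - 2 * n * p.
Proof.
move=> sA ee ff ef /=; have sAA : (A *m A)^T = A *m A by rewrite trmx_mul sA.
have t u : \tr (u^T *m u) = dotv u u by rewrite mxtrace_mulC trace_mx11.
rewrite /hessW plane_mx_sqr // !mxtrace_mul_plane_mx // !bilM //.
rewrite -scalemxAr !mxtraceZ !(mulmxDr, mxtraceD) !mxtrace_outer !t ee ff; ring.
Qed.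
End Plane.

Section Positivity.
Context {R : realDomainType} {n : nat}.
Implicit Types (X N Z : 'M[R]_n) (e f u v : 'rV[R]_n).

Lemma dotv_ge0 u : 0 <= dotv u u.
Proof. by rewrite dotvE sumr_ge0 // => i _; rewrite -expr2 sqr_ge0. Qed.

Lemma dotv_eq0 u : (dotv u u == 0) = (u == 0).
Proof.
apply/eqP/eqP => [|->]; last by rewrite /dotv mul0mx mxE.
move=> u0; apply/rowP => i; rewrite mxE; apply/eqP; rewrite -sqrf_eq0 expr2.
move: u0; rewrite dotvE => /psumr_eq0P u0; apply/eqP/u0 => // j _.
by rewrite -expr2 sqr_ge0.
Qed.

Lemma mxtrace_congr N Z : \tr (Z *m N *m Z^T) = \sum_i bil N (row i Z) (row i Z).
Proof.
apply: eq_bigr => i _; rewrite /bil -row_mul mxE [RHS]mxE.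
by apply: eq_bigr => j _; rewrite !mxE.
Qed.

(** All trace inequalities below come from this one, by a choice of [N] and
    [Z]. *)
Lemma mxtrace_congr_ge0 N Z :
  (forall i, 0 <= bil N (row i Z) (row i Z)) -> 0 <= \tr (Z *m N *m Z^T).
Proof. by move=> N0; rewrite mxtrace_congr sumr_ge0. Qed.

Lemma mxtrace_sqr_ge0 X : X^T = X -> 0 <= \tr (X *m X).
Proof.
move=> sX; have := @mxtrace_congr_ge0 1%:M X; rewrite mulmx1 sX; apply => i.
by rewrite bil_dotv mulmx1 dotv_ge0.
Qed.

Lemma bessel2 e f u : dotv e e = 1 -> dotv f f = 1 -> dotv e f = 0 ->
  dotv u e ^+ 2 + dotv u f ^+ 2 <= dotv u u.
Proof.
move=> ee ff ef; have := dotv_ge0 (u - dotv u e *: e - dotv u f *: f).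
rewrite !(dotvDl, dotvDr, dotvNl, dotvNr, dotvZl, dotvZr) ee ff ef.
by rewrite (dotvC f e) ef (dotvC e u) (dotvC f u); nra.
Qed.

Lemma mxtraceB X Y : \tr (X - Y) = \tr X - \tr Y.
Proof. exact: raddfB. Qed.

Lemma mxtraceN X : \tr (- X) = - \tr X.
Proof. exact: raddfN. Qed.

Lemma mxtrace_sqrB X Y :
  \tr ((X - Y) *m (X - Y)) = \tr (X *m X) - 2 * \tr (X *m Y) + \tr (Y *m Y).
Proof. by rewrite mulmxBl !mulmxBr !mxtraceB (mxtrace_mulC Y X); ring. Qed.

Lemma mxtrace_congr_subZ X N (a : R) :
  \tr ((X - a%:M) *m N *m (X - a%:M))
    = \tr (X *m N *m X) - 2 * a * \tr (N *m X) + a ^+ 2 * \tr N.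
Proof.
rewrite mulmxBr !mulmxBl !mxtraceB mul_scalar_mx !mul_mx_scalar -scalemxAl !mxtraceZ.
by rewrite (mxtrace_mulC X N); ring.
Qed.

(** When [e N = 0], the component of [X - a] along [e] contributes
    [bil N (e X) (e X)] to the trace of [(X - a) N (X - a)]. Removing this
    component leaves the trace of a congruence of [N], so nothing is lost in
    positivity and [bil N (e X) (e X)] is gained. *)
Lemma mxtrace_congr_deflate X N e a : X^T = X -> N^T = N ->
  dotv e e = 1 -> e *m N = 0 ->
  let Z := X - a%:M - e^T *m (e *m X) in
  \tr (Z *m N *m Z^T)
    = \tr (X *m N *m X) - bil N (e *m X) (e *m X) - 2 * a * \tr (N *m X)
      + a ^+ 2 * \tr N.
Proof.
move=> sX sN ee eN /=; set v := e *m X; set Y := X - a%:M.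
have sY : Y^T = Y by rewrite linearB /= sX tr_scalar_mx.
have vNe : bil N v e = 0 by rewrite bilC // bil_dotv eN /dotv mul0mx mxE.
have eNv : bil N e v = 0 by rewrite bil_dotv eN /dotv mul0mx mxE.
have eY : e *m Y = v - a *: e by rewrite mulmxBr mul_mx_scalar.
have -> : (Y - e^T *m v)^T = Y - v^T *m e by rewrite linearB /= sY trmx_mul trmxK.
have t1 : \tr (Y *m N *m (v^T *m e)) = bil N v v.
  rewrite mxtrace_outer bil_dotv mulmxA eY mulmxBl -scalemxAl dotvDl dotvNl dotvZl.
  by rewrite -!bil_dotv eNv mulr0 subr0.
have t2 : \tr (e^T *m v *m N *m Y) = bil N v v.
  rewrite -t1 -mxtrace_tr !trmx_mul trmxK sN sY; congr (\tr _).
  by rewrite !mulmxA.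
have t3 : \tr (e^T *m v *m N *m (v^T *m e)) = bil N v v.
  rewrite mxtrace_outer !bil_dotv !mulmxA (mx11_scalar (e *m e^T)) -/(dotv e e) ee.
  by rewrite mul1mx.
have expand (Y0 E0 G0 : 'M[R]_n) : (Y0 - E0) *m N *m (Y0 - G0)
    = Y0 *m N *m Y0 - E0 *m N *m Y0 - (Y0 *m N *m G0 - E0 *m N *m G0).
  by rewrite mulmxBr !mulmxBl.
by rewrite expand 3!mxtraceB t1 t2 t3 mxtrace_congr_subZ; ring.
Qed.

(** The difference of the two sides is the squared norm of what remains of [X]
    once its row and its column along [e] are deleted. *)
Lemma mxtrace_sqr_ge_row X e : X^T = X -> dotv e e = 1 ->
  2 * dotv (e *m X) (e *m X) - bil X e e ^+ 2 <= \tr (X *m X).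
Proof.
move=> sX ee; set v := e *m X; set s := bil X e e.
pose Z := X - (e^T *m v + v^T *m e - s *: (e^T *m e)).
have sZ : Z^T = Z.
  by apply/matrixP => i j; rewrite /Z !mxE !big_ord1 !mxE -[in X j i]sX !mxE; ring.
have := mxtrace_sqr_ge0 sZ.
have ve : dotv v e = s by [].
have ev : dotv e v = s by rewrite dotvC.
have vs : v *m X = v *m X by [].
rewrite /Z; set Y := (_ + _ - _).
rewrite mxtrace_sqrB.
have -> : \tr (X *m Y) = 2 * dotv v v - s ^+ 2.
  rewrite /Y mulmxBr mulmxDr mxtraceB mxtraceD -scalemxAr mxtraceZ !mxtrace_outer.
  rewrite (bilC v e sX) // !bil_dotv -/v ve; ring.
have -> : \tr (Y *m Y) = 2 * dotv v v - s ^+ 2.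
  have t a b : \tr (a^T *m b) = dotv b a :> R by rewrite mxtrace_mulC trace_mx11.
  rewrite /Y; do ?rewrite mulmxBl; do ?rewrite mulmxBr; do ?rewrite mulmxDl; do ?rewrite mulmxDr.
  rewrite -!scalemxAl -!scalemxAr !outer_mul !(mxtraceB, mxtraceN, mxtraceD, mxtraceZ) !t.
  rewrite ee ve ev. ring.
lra.
Qed.

Lemma mxtrace_sqr_ge_diag X e f : X^T = X ->
  dotv e e = 1 -> dotv f f = 1 -> dotv e f = 0 ->
  bil X e e ^+ 2 + bil X f f ^+ 2 <= \tr (X *m X).
Proof.
move=> sX ee ff ef; set a := bil X e e; set b := bil X f f.
pose Y := a *: (e^T *m e) + b *: (f^T *m f).
have sZ : (X - Y)^T = X - Y.
  by apply/matrixP => i j; rewrite /Y !mxE !big_ord1 !mxE -[in X j i]sX !mxE; ring.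
have := mxtrace_sqr_ge0 sZ.
have fe : dotv f e = 0 by rewrite dotvC.
rewrite mxtrace_sqrB.
have -> : \tr (X *m Y) = a ^+ 2 + b ^+ 2.
  rewrite /Y mulmxDr mxtraceD -!scalemxAr !mxtraceZ !mxtrace_outer -/a -/b; ring.
have -> : \tr (Y *m Y) = a ^+ 2 + b ^+ 2.
  have t u v : \tr (u^T *m v) = dotv v u :> R by rewrite mxtrace_mulC trace_mx11.
  rewrite /Y mulmxDl !mulmxDr -!scalemxAl -!scalemxAr !outer_mul !mxtraceD !mxtraceZ !t.
  rewrite ee ff ef fe; ring.
lra.
Qed.
End Positivity.

(** * Two unit matrices with close Hessians *)

(** Throughout the section [small] denies the gap to be established, with
    [eta] in place of [1 / (n + 3)]. *)
Section SmallGap.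
Context {R : rcfType} {n : nat}.
Variables (A B S C : 'M[R]_n) (eta dl : R).
Hypothesis SE : S = A + B.
Hypothesis CE : C = A - B.
Hypothesis dlE : dl = \tr (A *m A *m A) - \tr (B *m B *m B).
Hypothesis sA : A^T = A.
Hypothesis sB : B^T = B.
Hypothesis dl_gt0 : 0 < dl.
Hypothesis eta_ge0 : 0 <= eta.
Hypothesis eta_le : eta <= 1 / 6.
(* closes side conditions [0 <= 1 / 2 - eta] below *)
Let eta_half : eta <= 1 / 2. Proof. by move: eta_le; lra. Qed.
Hypothesis small : forall V : 'M[R]_n, V^T = V -> \tr V = 0 ->
  hessW A V - hessW B V <= eta * dl * \tr (V *m V).

Lemma sym_sum : S^T = S.
Proof. by rewrite SE linearD /= sA sB. Qed.

Lemma sym_diff : C^T = C.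
Proof. by rewrite CE linearB /= sA sB. Qed.

(** This is [small] for [V = plane_mx e f al be], with [A = (S + C) / 2] and
    [B = (S - C) / 2] substituted, doubled to clear denominators. Here [x] and
    [y] are the inner products of [V] with [S] and [C], while [P] and [Q] are
    those with [S^2 + C^2] and [S C + C S], and [|V|^2 = 2 n]. *)
Lemma gap_plane_mx (e f : 'rV[R]_n) (al be lam : R) :
  dotv e e = 1 -> dotv f f = 1 -> dotv e f = 0 -> e *m C = lam *: e ->
  let n := al ^+ 2 + be ^+ 2 in
  let s1 := bil S e e in let s2 := bil S f f in let k := bil S e f in
  let l := bil C f f in
  let x := al * (s1 - s2) + 2 * be * k in
  let y := al * (lam - l) in
  let P := al * (dotv (e *m S) (e *m S) - dotv (f *m S) (f *m S)
             + lam ^+ 2 - dotv (f *m C) (f *m C))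
           + 2 * be * dotv (e *m S) (f *m S) in
  let Q := al * (2 * lam * s1 - 2 * dotv (f *m S) (f *m C))
           + 2 * be * (dotv (e *m S) (f *m C) + lam * k) in
  12 * n * (lam + l) - 3 * (P * y + Q * x)
  + 3 / 2 * dl * (x ^+ 2 + y ^+ 2)
  + 3 * (\tr (A *m A *m A) + \tr (B *m B *m B)) * x * y
  - 4 * n * dl <= 4 * eta * dl * n.
Proof.
move=> ee ff ef Ce /=.
set s1 := bil S e e; set s2 := bil S f f; set k := bil S e f; set l := bil C f f.
have := small (plane_mx_sym e f al be) (mxtrace_plane_mx al be ee ff ef).
rewrite !hessW_plane_mx // plane_mx_sqr // mxtraceZ mxtraceD.
have t (u : 'rV[R]_n) : \tr (u^T *m u) = dotv u u.
  by rewrite mxtrace_mulC trace_mx11.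
rewrite !t ee ff.
have hA : A = 2^-1 *: (S + C).
  by apply/matrixP => i j; rewrite SE CE !mxE; field.
have hB : B = 2^-1 *: (S - C).
  by apply/matrixP => i j; rewrite SE CE !mxE; field.
have eA : e *m A = 2^-1 *: (e *m S + lam *: e).
  by rewrite {1}hA -scalemxAr mulmxDr Ce.
have eB : e *m B = 2^-1 *: (e *m S - lam *: e).
  by rewrite {1}hB -scalemxAr mulmxBr Ce.
have fA : f *m A = 2^-1 *: (f *m S + f *m C).
  by rewrite {1}hA -scalemxAr mulmxDr.
have fB : f *m B = 2^-1 *: (f *m S - f *m C).
  by rewrite {1}hB -scalemxAr mulmxBr.
have efC : dotv e (f *m C) = 0.
  by rewrite dotvC -bil_dotv (bilC f e sym_diff) bil_dotv Ce dotvZl ef mulr0.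
have fe : dotv f e = 0 by rewrite dotvC.
have hk : dotv (f *m S) e = k by rewrite -bil_dotv (bilC f e sym_sum).
rewrite !bil_dotv eA eB fA fB !(dotvZl, dotvZr, dotvDl, dotvDr, dotvNl, dotvNr).
have hk' : dotv e (f *m S) = k by rewrite dotvC.
have he : dotv e (e *m S) = s1 by rewrite dotvC.
have eh : dotv (f *m C) e = 0 by rewrite dotvC.
have hs2 : dotv (f *m S) f = s2 by [].
have hl : dotv (f *m C) f = l by [].
have hs1 : dotv (e *m S) e = s1 by [].
have hkk : dotv (e *m S) f = k by [].
rewrite ?(ee, ff, ef, fe, hk, hk', he, eh, efC, hs1, hs2, hl, hkk).
rewrite ?(dotvC (f *m C) (e *m S)) ?(dotvC (f *m C) (f *m S)) ?(dotvC (f *m S) (e *m S)).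
rewrite dlE -(ler_pM2l (x := 2)) //.
move: (\tr (A *m A *m A)) (\tr (B *m B *m B)) => p q.
set a := dotv (e *m S) (e *m S); set b := dotv (f *m S) (f *m S).
set c := dotv (e *m S) (f *m S); set d := dotv (f *m C) (f *m C).
set g := dotv (e *m S) (f *m C); set h := dotv (f *m S) (f *m C).
by move=> H; apply: (eq_ind _ is_true H); congr (_ <= _); field.
Qed.

Let h := (1 + eta) * dl / 3.

Lemma cube_gap_split :
  dl = 3 / 4 * \tr (C *m S *m S) + 1 / 4 * \tr (C *m C *m C).
Proof.
have rot (X Y Z : 'M[R]_n) : \tr (X *m Y *m Z) = \tr (Y *m Z *m X).
  by rewrite -mulmxA mxtrace_mulC.
rewrite dlE CE SE !(mulmxDl, mulmxDr, mulNmx, mulmxN) !(mxtraceD, mxtraceN).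
rewrite (rot A A B) (rot A B A) (rot A B B) (rot B A B) ?(rot B A A) ?(rot B B A).
rewrite ?(rot A A B) ?(rot A B B) ?(rot B B A).
by field; rewrite ?pnatr_eq0.
Qed.

(** The off-diagonal test matrix ([al = 0]) gives the conclusion multiplied by
    [1 - k^2], where [k = bil S e f]. The assumption on the cross term holds
    both when [f] is an eigenvector of [C] and when [e S] lies in the plane of
    [e] and [f]. *)
Lemma eigen_sum_le_of_lt1 (e f : 'rV[R]_n) (lam : R) :
  dotv e e = 1 -> dotv f f = 1 -> dotv e f = 0 -> e *m C = lam *: e ->
  bil S e f * dotv (e *m S) (f *m C) = bil S e f ^+ 2 * bil C f f ->
  bil S e f ^+ 2 < 1 -> lam + bil C f f <= h.
Proof.
move=> ee ff ef Ce hk k1.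
have := gap_plane_mx 0 1 ee ff ef Ce.
set k := bil S e f in hk k1 *; set l := bil C f f in hk *.
set g := dotv _ (f *m C) in hk *.
move=> H.
have {H} : 12 * (lam + l) - 3 * (4 * (k * g + lam * k ^+ 2)) + 6 * dl * k ^+ 2
   - 4 * dl <= 4 * eta * dl.
  by apply: (eq_ind _ is_true H); congr (_ <= _); field.
rewrite hk => H.
have H2 : (lam + l) * (3 * (1 - k ^+ 2)) <= (1 + eta) * dl * (1 - k ^+ 2).
  have : 0 <= dl * k ^+ 2 * (1 / 2 - eta).
    by apply: mulr_ge0; [exact: mulr_ge0 (ltW dl_gt0) (sqr_ge0 k) | rewrite subr_ge0].
  move: H; rewrite -/k; nra.
rewrite /h ler_pdivlMr // -(ler_pM2r (x := 1 - k ^+ 2)) ?subr_gt0 //.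
by rewrite -mulrA.
Qed.

Variable c : R.
Hypothesis SS : \tr (S *m S) = 4 * c.
Hypothesis CC : \tr (C *m C) = 4 * (1 - c).
Hypothesis SC : \tr (C *m S) = 0.
Hypothesis trS : \tr S = 0.
Hypothesis trC : \tr C = 0.

(** If [bil S e f ^+ 2 >= 1] the off-diagonal test is void, and the test
    matrix orthogonal to [S] is used instead. The terms that it leaves over
    have a favourable sign, by Bessel's inequality for [f S] and [f C], because
    [e S] has no component outside the plane of [e] and [f]. *)
Lemma eigen_sum_le (e f : 'rV[R]_n) (lam : R) :
  dotv e e = 1 -> dotv f f = 1 -> dotv e f = 0 -> e *m C = lam *: e ->
  e *m S = bil S e e *: e + bil S e f *: f ->
  bil C f f <= lam -> lam + bil C f f <= h.
Proof.
move=> ee ff ef Ce Se lel.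
have fe : dotv f e = 0 by rewrite dotvC.
have [k1|k1] := ltP (bil S e f ^+ 2) 1.
  apply: (eigen_sum_le_of_lt1 ee ff ef Ce) => //.
  have efC : dotv e (f *m C) = 0.
    by rewrite dotvC -bil_dotv (bilC f e sym_diff) bil_dotv Ce dotvZl ef mulr0.
  rewrite {1}Se dotvDl !dotvZl efC (dotvC f) -[dotv (f *m C) f]bil_dotv; ring.
have h0 : 0 <= h by apply: divr_ge0 => //; apply: mulr_ge0 (ltW dl_gt0); exact: addr_ge0.
have [l0|l0] := leP (lam + bil C f f) 0; first exact: le_trans h0.
have := gap_plane_mx (2 * bil S e f) (bil S f f - bil S e e) ee ff ef Ce.
have fSe : dotv (f *m S) e = bil S e f by rewrite -bil_dotv (bilC f e sym_sum).
have bS := bessel2 (f *m S) ee ff ef; rewrite fSe -[dotv (f *m S) f]bil_dotv in bS.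
have bC := bessel2 (f *m C) ee ff ef.
have fCe : dotv (f *m C) e = 0.
  by rewrite -bil_dotv (bilC f e sym_diff) bil_dotv Ce dotvZl ef mulr0.
rewrite fCe -[dotv (f *m C) f]bil_dotv expr0n add0r in bC.
have rS := mxtrace_sqr_ge_row sym_sum ee.
have dC := mxtrace_sqr_ge_diag sym_diff ee ff ef.
have Cee : bil C e e = lam by rewrite bil_dotv Ce dotvZl ee mulr1.
rewrite Cee CC in dC.
have v2 : dotv (e *m S) (e *m S) = bil S e e ^+ 2 + bil S e f ^+ 2.
  rewrite Se !(dotvDl, dotvDr, dotvZl, dotvZr) ee ff ef fe; ring.
have v3 : dotv (e *m S) (f *m S) = bil S e f * (bil S e e + bil S f f).
  rewrite {1}Se !(dotvDl, dotvZl) (dotvC e) fSe (dotvC f) -bil_dotv; ring.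
rewrite v2 SS in rS; rewrite v2 v3.
move: bS bC dC rS k1 lel l0.
set s1 := bil S e e; set s2 := bil S f f; set k := bil S e f; set l := bil C f f.
set b := dotv (f *m S) (f *m S); set d := dotv (f *m C) (f *m C).
move=> bS bC dC rS k1 lel l0.
pose T := (2 * k) ^+ 2 + (s2 - s1) ^+ 2 => H.
pose W := (2 * k) ^+ 2 * (lam - l) ^+ 2.
have {}H : 12 * T * (lam + l) - 3 * W * (lam + l) + 3 / 2 * dl * W - 4 * T * dl
    + 3 * (2 * k) ^+ 2 * (lam - l) * ((b - k ^+ 2 - s2 ^+ 2) + (d - l ^+ 2))
    <= 4 * eta * dl * T.
  by apply: (eq_ind _ is_true H); congr (_ <= _); rewrite /W /T; field.
have pos : 0 <= 3 * (2 * k) ^+ 2 * (lam - l) * ((b - k ^+ 2 - s2 ^+ 2) + (d - l ^+ 2)).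
  apply: mulr_ge0; last by move: bS bC; lra.
  apply: mulr_ge0; last by rewrite subr_ge0.
  by apply: mulr_ge0 => //; exact: sqr_ge0.
have T0 : 0 < T.
  by have := sqr_ge0 (s2 - s1); rewrite /T exprMn; lra.
have W0 : 0 <= W := mulr_ge0 (sqr_ge0 _) (sqr_ge0 _).
have WT : W < 4 * T.
  have TW : (2 * k) ^+ 2 <= T by rewrite lerDl sqr_ge0.
  have D4 : (lam - l) ^+ 2 < 4.
    have : 0 < (lam + l) ^+ 2 by rewrite exprn_gt0.
    nra.
  apply: le_lt_trans (_ : T * (lam - l) ^+ 2 < _).
    by rewrite ler_wpM2r ?sqr_ge0.
  by rewrite mulrC ltr_pM2r.
rewrite /h ler_pdivlMr // -(ler_pM2r (x := 4 * T - W)) ?subr_gt0 //.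
have : 0 <= dl * W * (1 / 2 - eta).
  by apply: mulr_ge0; [exact: mulr_ge0 (ltW dl_gt0) W0 | rewrite subr_ge0].
nra.
Qed.

Section TopEigenvector.
Variables (e : 'rV[R]_n) (lam : R).
Hypothesis ee : dotv e e = 1.
Hypothesis Ce : e *m C = lam *: e.
Hypothesis Cle : forall u, bil C u u <= lam * dotv u u.

Lemma mxtrace_congr_top Z : Z^T = Z -> \tr (C *m Z *m Z) <= lam * \tr (Z *m Z).
Proof.
move=> sZ; have : 0 <= \tr (Z *m (lam *: 1%:M - C) *m Z^T).
  by apply: mxtrace_congr_ge0 => i; rewrite bilDM bilNM bilZM bil1M subr_ge0 Cle.
rewrite sZ mulmxBr mulmxBl -scalemxAr mulmx1 -scalemxAl mxtraceB mxtraceZ subr_ge0.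
by rewrite -mulmxA mxtrace_mulC.
Qed.

Lemma mxtrace_cube_diff_le : \tr (C *m C *m C) <= lam * (4 * (1 - c)).
Proof.
by rewrite -CC; exact: mxtrace_congr_top sym_diff.
Qed.

Lemma c_ge0 : 0 <= c.
Proof. have := mxtrace_sqr_ge0 sym_sum; rewrite SS; lra. Qed.

Lemma c_le1 : c <= 1.
Proof. have := mxtrace_sqr_ge0 sym_diff; rewrite CC; lra. Qed.

Lemma cube_gap_le : dl <= 3 / 4 * \tr (C *m S *m S) + (1 - c) * lam.
Proof. by rewrite cube_gap_split; have := mxtrace_cube_diff_le; lra. Qed.

Lemma cube_gap_le_top : dl <= (1 + 2 * c) * lam.
Proof.
have := cube_gap_le.
by have := mxtrace_congr_top sym_sum; rewrite SS; lra.
Qed.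

Lemma lam_gt0 : 0 < lam.
Proof.
rewrite ltNge; apply/negP => l0; have := cube_gap_le_top; rewrite leNgt => /negP; apply.
by apply: le_lt_trans dl_gt0; rewrite mulr_ge0_le0 //; have := c_ge0; lra.
Qed.

Lemma top_row_le : 2 * dotv (e *m S) (e *m S) - bil S e e ^+ 2 <= 4 * c.
Proof. by rewrite -SS; exact: mxtrace_sqr_ge_row sym_sum ee. Qed.

(** Here [f] is an eigenvector for the second eigenvalue [lam2], assumed
    positive, and [k = bil S e f].

    If [k^2 < 1], then [lam + lam2 <= (1 + eta) dl / 3], and [dl <= 3 lam]
    shows that [lam2] is small compared with [lam]. The matrix
    [N = lam2 - C + (lam - lam2) e^T e] is positive semidefinite, and its
    congruence by [S - s1 / 2], with [s1 = bil S e e], yields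
    [tr(C S^2) <= 2 c (lam + lam2)], too small for [cube_gap_le].

    If [k^2 >= 1], then [c >= 1/2], and the test matrix orthogonal to [S] bounds
    [12 c (lam + lam2)] by [14/3 dl] plus a multiple of the squared length [a] of
    the part of [e S] outside the plane of [e] and [f]. The congruence of [N] by
    [S] bounds [dl] in turn, and [a] enters there with the right sign. *)
Lemma second_eigenvalue_npos (f : 'rV[R]_n) (lam2 : R) :
  eta <= 1 / (n%:R + 3) -> (1 < n)%N ->
  dotv f f = 1 -> dotv e f = 0 -> f *m C = lam2 *: f ->
  (forall u, dotv u e = 0 -> bil C u u <= lam2 * dotv u u) -> lam2 <= 0.
Proof.
move=> etan n1 ff ef Cf C2le; rewrite leNgt; apply/negP => l20.
have fe : dotv f e = 0 by rewrite dotvC.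
have c0 := c_ge0; have c1 := c_le1; have l0 := lam_gt0.
have dle := cube_gap_le; have dtop := cube_gap_le_top; have rS := top_row_le.
have Cff : bil C f f = lam2 by rewrite bil_dotv Cf dotvZl ff mulr1.
have l2l : lam2 <= lam by have := Cle f; rewrite Cff ff mulr1.
pose N := lam2 *: 1%:M - C + (lam - lam2) *: (e^T *m e).
have N0 u : 0 <= bil N u u.
  rewrite !bilDM bilNM !bilZM bil1M bil_outer.
  pose t := dotv u e; have := C2le (u - t *: e).
  have -> : dotv (u - t *: e) e = 0 by rewrite dotvDl dotvNl dotvZl ee mulr1 subrr.
  move=> /(_ erefl).
  have Ceu : bil C e u = lam * t by rewrite bil_dotv Ce dotvZl dotvC.
  rewrite -bil1M !bil_subZ !bil1M (bilC u e sym_diff) Ceu [bil C e e]bil_dotv Ce dotvZl ee (dotvC e u).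
  by rewrite -/t; lra.
have SNS : \tr (S *m N *m S) = lam2 * (4 * c) - \tr (C *m S *m S)
    + (lam - lam2) * dotv (e *m S) (e *m S).
  rewrite /N mulmxDr mulmxBr mulmxDl mulmxBl !(mxtraceB, mxtraceD).
  rewrite -!scalemxAr mulmx1 -!scalemxAl !mxtraceZ SS.
  have -> : \tr (S *m C *m S) = \tr (C *m S *m S) by rewrite -mulmxA mxtrace_mulC.
  by rewrite (mxtrace_mulC (S *m (e^T *m e)) S) [S *m (S *m _)]mulmxA mxtrace_outer bilM ?sym_sum.
have NS : \tr (N *m S) = (lam - lam2) * bil S e e.
  rewrite /N mulmxDl mulmxBl !(mxtraceB, mxtraceD) -!scalemxAl mul1mx !mxtraceZ trS SC.
  by rewrite (mxtrace_mulC _ S) mxtrace_outer; ring.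
have trN : \tr N = lam + (n%:R - 1) * lam2.
  rewrite /N !(mxtraceB, mxtraceD) !mxtraceZ trC mxtrace1 mxtrace_mulC trace_mx11.
  by rewrite -/(dotv e e) ee; ring.
have eSf : dotv (e *m S) (f *m C) = lam2 * bil S e f by rewrite Cf dotvZr.
have [k1|k1] := ltP (bil S e f ^+ 2) 1.
  have : lam + lam2 <= h.
    by rewrite -Cff; apply: (eigen_sum_le_of_lt1 ee ff ef Ce) => //; rewrite eSf Cff; ring.
  have : 0 <= \tr ((S - (bil S e e / 2)%:M) *m N *m (S - (bil S e e / 2)%:M)^T).
    by apply: mxtrace_congr_ge0.
  have -> : (S - (bil S e e / 2)%:M)^T = S - (bil S e e / 2)%:M.
    by rewrite linearB /= sym_sum tr_scalar_mx.
  rewrite mxtrace_congr_subZ SNS NS trN.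
  set s1 := bil S e e in rS *; set v2 := dotv _ _ in rS *; set X := \tr (_ *m S) in dle *.
  move=> H; rewrite /h ler_pdivlMr // => star.
  have m3 : eta * (n%:R + 3) <= 1.
    by rewrite -ler_pdivlMr // ltr_wpDl.
  (* dl <= 3 lam turns the bound on lam + lam2 into lam2 <= eta lam *)
  have l2small : (n%:R + 1) * lam2 <= lam.
    have n0 : 0 <= n%:R :> R by [].
    have d3 : dl <= 3 * lam by nra.
    have d4 : (1 + eta) * dl <= (1 + eta) * (3 * lam) by rewrite ler_wpM2l ?addr_ge0.
    have E1 : lam2 <= eta * lam by lra.
    apply: le_trans (_ : (n%:R + 1) * (eta * lam) <= _).
      by rewrite ler_wpM2l // addr_ge0.
    rewrite mulrA ler_piMl ?ltW //; nra.
  have HX : X <= 2 * c * (lam + lam2).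
    have : 0 <= (lam - lam2) * (4 * c + s1 ^+ 2 - 2 * v2).
      by rewrite mulr_ge0 ?subr_ge0 //; lra.
    have : 0 <= s1 ^+ 2 * (lam - (n%:R + 1) * lam2).
      by rewrite mulr_ge0 ?sqr_ge0 ?subr_ge0.
    nra.
  have P1 : 0 <= (1 - c) * (1 / 2 * lam + 3 / 2 * lam2).
    by apply: mulr_ge0; lra.
  have P2 : 0 <= dl * (1 / 2 - eta) by rewrite mulr_ge0 ?subr_ge0 ?(ltW dl_gt0).
  lra.
have fSe : dotv (f *m S) e = bil S e f by rewrite -bil_dotv (bilC f e sym_sum).
set al := 2 * bil S e f; set be := bil S f f - bil S e e.
have := gap_plane_mx al be ee ff ef Ce.
have eSe : dotv (e *m S) e = bil S e e by [].
have eSf' : dotv (e *m S) f = bil S e f by [].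
have fSf : dotv (f *m S) f = bil S f f by [].
rewrite Cff eSf Cf !dotvZr dotvZl ff fSf.
have bz := bessel2 (be *: (e *m S) - al *: (f *m S)) ee ff ef.
rewrite !(dotvDl, dotvNl, dotvDr, dotvNr, dotvZl, dotvZr) fSe eSe eSf' fSf in bz.
rewrite [dotv (f *m S) (e *m S)]dotvC in bz.
have be1 := bessel2 (e *m S) ee ff ef; rewrite eSe eSf' in be1.
have dC := mxtrace_sqr_ge_diag sym_diff ee ff ef.
have Cee : bil C e e = lam by rewrite bil_dotv Ce dotvZl ee mulr1.
rewrite Cee Cff CC in dC.
have HX : 0 <= \tr (S *m N *m S).
  by have := @mxtrace_congr_ge0 _ _ N S; rewrite sym_sum; apply.
rewrite SNS in HX.
move: HX dC be1 bz rS k1 dle dtop; rewrite /al /be.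
set s1 := bil S e e; set s2 := bil S f f; set k := bil S e f.
set p1 := dotv (e *m S) (e *m S); set p2 := dotv (f *m S) (f *m S).
set p3 := dotv (e *m S) (f *m S); set X := \tr (C *m S *m S).
move=> HX dC be1 bz rS k1 dle dtop.
pose T := (2 * k) ^+ 2 + (s2 - s1) ^+ 2 => H.
pose a := p1 - s1 ^+ 2 - k ^+ 2.
pose W := (2 * k) ^+ 2 * (lam - lam2) ^+ 2.
have a0 : 0 <= a by rewrite /a; lra.
(* If Y1, Y2 are the parts of e S, f S outside the plane of e and f, the left
   side is al^2 (|Y1|^2 - |Y2|^2) + 2 al be Y1.Y2, and [bz] says that
   |be Y1 - al Y2|^2 >= 0; here al = 2 k, be = s2 - s1 and |Y1|^2 = a. *)
have bad : (2 * k) ^+ 2 * (p1 - s1 ^+ 2 - (p2 - s2 ^+ 2))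
    + 2 * (2 * k) * (s2 - s1) * (p3 - s1 * k - k * s2) <= T * a.
  by rewrite /T /a; move: bz; lra.
have {}H : 12 * T * (lam + lam2) - 3 * W * (lam + lam2) + 3 / 2 * dl * W
    - 3 * (lam - lam2) * (T * a) - 4 * T * dl <= 4 * eta * dl * T.
  have : 0 <= (lam - lam2) * (T * a - ((2 * k) ^+ 2 * (p1 - s1 ^+ 2 - (p2 - s2 ^+ 2))
    + 2 * (2 * k) * (s2 - s1) * (p3 - s1 * k - k * s2))).
    by apply: mulr_ge0; rewrite subr_ge0.
  by move: H; rewrite /W /T; lra.
have c12 : 1 / 2 <= c by have := sqr_ge0 s1; lra.
have kT : (2 * k) ^+ 2 <= T by rewrite lerDl sqr_ge0.
have T0 : 0 < T by have := sqr_ge0 (s2 - s1); rewrite /T exprMn; lra.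
have Dlt : (lam - lam2) ^+ 2 <= 4 * (1 - c).
  have : 0 <= lam2 * lam by rewrite mulr_ge0 // ltW.
  nra.
have WT : W <= T * (4 * (1 - c)).
  apply: le_trans (_ : T * (lam - lam2) ^+ 2 <= _).
    by rewrite ler_wpM2r ?sqr_ge0.
  by rewrite ler_wpM2l // ltW.
have {}H : T * (12 * c * (lam + lam2)) <= T * (3 * (lam - lam2) * a + 14 / 3 * dl).
  have P1 : 0 <= (T * (4 * (1 - c)) - W) * (lam + lam2).
    by rewrite mulr_ge0 ?subr_ge0 //; lra.
  have P2 : 0 <= dl * W.
    by rewrite mulr_ge0 ?(ltW dl_gt0) //; apply: mulr_ge0; exact: sqr_ge0.
  have P3 : 0 <= dl * T * (1 / 6 - eta).
    by rewrite mulr_ge0 ?subr_ge0 // mulr_ge0 ?(ltW dl_gt0) ?(ltW T0).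
  lra.
rewrite ler_pM2l // in H.
have Q1 : 0 <= (lam - lam2) * (4 * c - 1 - p1 - a).
  by apply: mulr_ge0; rewrite ?subr_ge0 // /a; lra.
have Q2 : 0 <= (c - 1 / 2) * lam by apply: mulr_ge0; [rewrite subr_ge0 | exact: ltW].
have Q3 : 0 <= (c - 1 / 2) * lam2 by apply: mulr_ge0; [rewrite subr_ge0 | exact: ltW].
have Q4 : 0 <= (lam - lam2) * a by apply: mulr_ge0 => //; rewrite subr_ge0.
lra.
Qed.

(** Suppose that [C] is nonpositive on the complement of [e]. Every unit vector
    orthogonal to [e] and [f] can replace [f] in [eigen_sum_le_of_lt1], so
    [C <= h - lam] there; with [lam + bil C f f <= h] and [tr C = 0] this gives
    [lam <= 2 h]. On the other hand [lam e^T e - C] is positive semidefinite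
    and kills [e], and [mxtrace_congr_deflate] bounds [tr(C S^2)] by
    [bil S e f ^+ 2 * (lam + bil C f f) <= 2 c h]. These two bounds contradict
    [cube_gap_le]. *)
Lemma not_npos_off_top (f : 'rV[R]_n) : (3 <= n)%N ->
  dotv f f = 1 -> dotv e f = 0 -> e *m S = bil S e e *: e + bil S e f *: f ->
  ~ (forall u, dotv u e = 0 -> bil C u u <= 0).
Proof.
move=> n3 ff ef Se C0.
have fe : dotv f e = 0 by rewrite dotvC.
have c0 := c_ge0; have c1 := c_le1; have l0 := lam_gt0.
have dle := cube_gap_le; have rS := top_row_le.
have star : lam + bil C f f <= h.
  by apply: (eigen_sum_le ee ff ef Ce Se) => //; have := Cle f; rewrite ff mulr1.
have Cee : bil C e e = lam by rewrite bil_dotv Ce dotvZl ee mulr1.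
have Cef : bil C e f = 0 by rewrite bil_dotv Ce dotvZl ef mulr0.
have v2 : dotv (e *m S) (e *m S) = bil S e e ^+ 2 + bil S e f ^+ 2.
  rewrite Se !(dotvDl, dotvDr, dotvZl, dotvZr) ee ff ef fe; ring.
have perp u : dotv u e = 0 -> dotv u f = 0 -> bil C u u <= (h - lam) * dotv u u.
  move=> ue uf; have [->|u0] := eqVneq u 0; first by rewrite bil_dotv /dotv !mul0mx mxE mulr0.
  have du : 0 < dotv u u by rewrite lt_def dotv_eq0 u0 dotv_ge0.
  pose r := (Num.sqrt (dotv u u))^-1.
  have rr : r ^+ 2 * dotv u u = 1 by rewrite exprVn sqr_sqrtr ?ltW // mulVf // gt_eqF.
  have eSu : bil S e (r *: u) = 0.
    by rewrite bil_dotv dotvZr Se dotvDl !dotvZl (dotvC e) (dotvC f) ue uf; ring.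
  have := @eigen_sum_le_of_lt1 e (r *: u) lam ee _ _ Ce.
  rewrite eSu expr0n /= !mul0r dotvZl !dotvZr mulrA -expr2 rr (dotvC e u) ue mulr0.
  move=> /(_ erefl erefl erefl ltr01).
  rewrite bil_dotv -scalemxAl dotvZl dotvZr -bil_dotv mulrA -expr2 => H.
  have -> : bil C u u = (r ^+ 2 * bil C u u) * dotv u u by rewrite mulrAC rr mul1r.
  by rewrite ler_wpM2r ?dotv_ge0 //; lra.
have lam2h : lam <= 2 * h.
  (* compress (h - lam) - C to the complement of e and f and take the trace *)
  pose P : 'M[R]_n := 1%:M - (e^T *m e + f^T *m f).
  have sP : P^T = P by rewrite linearB linearD /= trmx1 !trmx_mul !trmxK.
  have rP i : row i P = delta_mx 0 i - (e 0 i *: e + f 0 i *: f).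
    rewrite linearB linearD /= row1 !row_mul; congr (_ - (_ + _)).
      by rewrite (mx11_scalar (row i e^T)) mul_scalar_mx !mxE.
    by rewrite (mx11_scalar (row i f^T)) mul_scalar_mx !mxE.
  have rPe i : dotv (row i P) e = 0.
    by rewrite rP dotvDl dotvNl dotvDl !dotvZl dotv_delta ee fe; ring.
  have rPf i : dotv (row i P) f = 0.
    by rewrite rP dotvDl dotvNl dotvDl !dotvZl dotv_delta ff ef; ring.
  have PP : P *m P = P.
    rewrite {1}/P mulmxBl mul1mx mulmxDl.
    have eP : e *m P = 0.
      rewrite /P mulmxBr mulmx1 mulmxDr !mulmxA.
      rewrite [e *m _](mx11_scalar (e *m e^T)) -/(dotv e e) ee mul1mx.
      rewrite [e *m _](mx11_scalar (e *m f^T)) -/(dotv e f) ef mul_scalar_mx scale0r.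
      by rewrite addr0 subrr.
    have fP : f *m P = 0.
      rewrite /P mulmxBr mulmx1 mulmxDr !mulmxA.
      rewrite [f *m _](mx11_scalar (f *m e^T)) -/(dotv f e) fe mul_scalar_mx scale0r.
      rewrite [f *m _](mx11_scalar (f *m f^T)) -/(dotv f f) ff mul1mx.
      by rewrite add0r subrr.
    rewrite -!mulmxA eP fP !mulmx0.
    by rewrite addr0 subr0.
  have : 0 <= \tr (P *m ((h - lam)%:M - C) *m P^T).
    apply: mxtrace_congr_ge0 => i.
    rewrite -scalemx1 bilDM bilNM bilZM bil1M subr_ge0.
    exact: perp.
  rewrite sP -mulmxA mxtrace_mulC -mulmxA PP mulmxBl mxtraceB mul_scalar_mx mxtraceZ.
  rewrite /P mulmxBr mulmxDr mulmx1 !mxtraceB !mxtraceD !mxtrace_outer trC mxtrace1.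
  rewrite ![\tr (_^T *m _)]mxtrace_mulC !trace_mx11 -/(dotv e e) -/(dotv f f) ee ff Cee.
  have n3' : 3 <= n%:R :> R by rewrite ler_nat.
  have h0 : 0 < h by rewrite divr_gt0 // mulr_gt0 // ltr_wpDr.
  move=> H; rewrite leNgt; apply/negP => l2h.
  have : 0 <= (lam - h) * (n%:R - 3) by rewrite mulr_ge0 // ?subr_ge0 //; lra.
  lra.
have X : \tr (C *m S *m S) <= bil S e f ^+ 2 * (lam + bil C f f).
  set s1 := bil S e e in Se v2 *; set v := e *m S in Se v2 *.
  pose N := lam *: (e^T *m e) - C.
  have N0 u : 0 <= bil N u u.
    rewrite bilDM bilNM bilZM bil_outer; pose t := dotv u e.
    have := C0 (u - t *: e).
    have -> : dotv (u - t *: e) e = 0 by rewrite dotvDl dotvNl dotvZl ee mulr1 subrr.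
    move=> /(_ erefl).
    have Ceu : bil C e u = lam * t by rewrite bil_dotv Ce dotvZl dotvC.
    by rewrite bil_subZ (bilC u e sym_diff) Ceu Cee (dotvC e u) -/t; lra.
  have eN : e *m N = 0.
    rewrite /N mulmxBr Ce -scalemxAr mulmxA (mx11_scalar (e *m e^T)) -/(dotv e e) ee.
    by rewrite mul1mx subrr.
  have : 0 <= \tr ((S - s1%:M - e^T *m v) *m N *m (S - s1%:M - e^T *m v)^T).
    by apply: mxtrace_congr_ge0.
  have sN : N^T = N.
    by rewrite linearB linearZ /= trmx_mul trmxK sym_diff.
  rewrite mxtrace_congr_deflate ?sym_sum // -/v.
  have -> : \tr (S *m N *m S) = lam * dotv v v - \tr (C *m S *m S).
    rewrite /N mulmxBr mulmxBl mxtraceB -scalemxAr -scalemxAl mxtraceZ.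
    rewrite (mxtrace_mulC (S *m (e^T *m e)) S) [S *m (S *m _)]mulmxA mxtrace_outer bilM ?sym_sum //.
    by rewrite -mulmxA (mxtrace_mulC S).
  have -> : \tr (N *m S) = lam * s1.
    by rewrite /N mulmxBl mxtraceB SC -scalemxAl mxtraceZ (mxtrace_mulC _ S) mxtrace_outer subr0.
  have -> : \tr N = lam.
    by rewrite /N mxtraceB mxtraceZ trC mxtrace_mulC trace_mx11 -/(dotv e e) ee mulr1 subr0.
  have -> : bil N v v = - (bil S e f ^+ 2 * bil C f f).
    rewrite /N bilDM bilNM bilZM bil_outer Se.
    rewrite !bil_dotv !mulmxDl -!scalemxAl !(dotvDl, dotvDr, dotvZl, dotvZr) -!bil_dotv.
    rewrite (bilC f e sym_diff) Cee Cef ee ef fe; ring.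
  rewrite v2; lra.
have k2 : bil S e f ^+ 2 <= 2 * c.
  by move: rS; rewrite v2; have := sqr_ge0 (bil S e e); lra.
have h3 : 3 * h = (1 + eta) * dl by rewrite /h mulrC divfK // pnatr_eq0.
have h0 : 0 <= h by rewrite divr_ge0 // mulr_ge0 ?(ltW dl_gt0) // addr_ge0.
have Y : bil S e f ^+ 2 * (lam + bil C f f) <= 2 * c * h.
  apply: le_trans (_ : bil S e f ^+ 2 * h <= _).
    by rewrite ler_wpM2l ?sqr_ge0.
  by rewrite ler_wpM2r.
have Z1 : 0 <= (1 - c) * (2 * h - lam) by rewrite mulr_ge0 // subr_ge0.
have Z2 : 0 <= c * h by rewrite mulr_ge0.
have Z3 : 0 <= dl * (1 / 6 - eta) by rewrite mulr_ge0 ?subr_ge0 ?(ltW dl_gt0).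
by move: dl_gt0; lra.
Qed.
End TopEigenvector.
End SmallGap.

(** * Functions built from linear forms and the inverse norm *)

Section Radial.
Context {R : realType} {n : nat}.
Implicit Types (x y v : 'rV[R]_n).

Definition rho x : R := Num.sqrt (dotv x x).

Lemma rho_gt0 x : x != 0 -> 0 < rho x.
Proof. by move=> x0; rewrite sqrtr_gt0 lt_def dotv_eq0 x0 dotv_ge0. Qed.

Lemma rho_neq0 x : x != 0 -> rho x != 0.
Proof. by move=> /rho_gt0; rewrite lt_def => /andP[]. Qed.

Lemma sqr_rho x : rho x ^+ 2 = dotv x x.
Proof. by rewrite sqr_sqrtr ?dotv_ge0. Qed.

Definition unitv x : 'rV[R]_n := (rho x)^-1 *: x.

Lemma dotv_unitv x : x != 0 -> dotv (unitv x) (unitv x) = 1.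
Proof.
move=> x0; rewrite dotvZl dotvZr -sqr_rho expr2 mulKf ?rho_neq0 //.
by rewrite mulVf ?rho_neq0.
Qed.

Lemma bil_unitv (M : 'M[R]_n) v : bil M (unitv v) (unitv v) = bil M v v / dotv v v.
Proof.
rewrite bil_dotv /unitv -scalemxAl dotvZl dotvZr -bil_dotv mulrA -expr2 exprVn sqr_rho.
by rewrite mulrC.
Qed.

Lemma coord_le_normr (x : 'rV[R]_n) i : `|x 0 i| <= `|x|.
Proof.
rewrite [leRHS]/Num.norm /= mx_normrE.
by apply: (le_trans _ (le_bigmax _ _ (0, i))).
Qed.

(** Syntax, so that a derivative is again of this kind and the degree of
    homogeneity can be read off: each regularity statement about [w] becomes an
    induction. *)
Inductive rexpr : Type :=
| RCst of R
| RLin of 'rV[R]_n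
| RInvNorm
| RAdd of rexpr & rexpr
| RMul of rexpr & rexpr.

Fixpoint reval (a : rexpr) x : R :=
  match a with
  | RCst c => c
  | RLin u => dotv x u
  | RInvNorm => (rho x)^-1
  | RAdd a b => reval a x + reval b x
  | RMul a b => reval a x * reval b x
  end.

Fixpoint rder v (a : rexpr) : rexpr :=
  match a with
  | RCst c => RCst 0
  | RLin u => RCst (dotv v u)
  | RInvNorm =>
      RMul (RMul (RCst (-1)) (RLin v)) (RMul RInvNorm (RMul RInvNorm RInvNorm))
  | RAdd a b => RAdd (rder v a) (rder v b)
  | RMul a b => RAdd (RMul a (rder v b)) (RMul (rder v a) b)
  end.

(** The constant 0 has every degree, so that differentiation lowers the degree
    by one without exception. *)
Inductive rhom : rexpr -> int -> Prop :=
| rhom_cst0 k : rhom (RCst 0) k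
| rhom_cst c : rhom (RCst c) 0
| rhom_lin u : rhom (RLin u) 1
| rhom_inv : rhom RInvNorm (-1)
| rhom_add a b k : rhom a k -> rhom b k -> rhom (RAdd a b) k
| rhom_mul a b k l p : rhom a k -> rhom b l -> k + l = p -> rhom (RMul a b) p.

Lemma derive_coord (i : 'I_n) x v : 'D_v (fun y : 'rV[R]_n => y 0 i) x = v 0 i.
Proof.
apply: cvg_lim => //; apply: (@cvg_trans _ (cst (v 0 i) @ (0 : R)^')); last exact: cvg_cst.
apply: near_eq_cvg; near=> h; rewrite /= !mxE addrK /GRing.scale /= mulKf //.
by near: h; exact: nbhs_dnbhs_neq.
Unshelve. all: by end_near. Qed.

Lemma dotv_funE : (fun y : 'rV[R]_n => dotv y y) = \sum_i ((fun y : 'rV[R]_n => y 0 i) * (fun y => y 0 i)).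
Proof. by apply/funext => y; rewrite dotvE fct_sumE. Qed.

Lemma differentiable_dotv x : differentiable (fun y : 'rV[R]_n => dotv y y) x.
Proof.
rewrite dotv_funE; apply: differentiable_sum => i.
by apply: differentiableM; exact: differentiable_coord.
Qed.

Lemma derive_dotv x v : 'D_v (fun y : 'rV[R]_n => dotv y y) x = 2 * dotv x v.
Proof.
rewrite dotv_funE derive_sum => [|i]; last first.
  by apply: derivableM; apply: diff_derivable; exact: differentiable_coord.
rewrite dotvE mulr_sumr; apply: eq_bigr => i _.
have dc : derivable (fun y : 'rV[R]_n => y 0 i) x v by apply/diff_derivable/differentiable_coord.
by rewrite deriveM // derive_coord /GRing.scale /=; ring.
Qed.

Lemma is_derive_invsqrt (s : R) : 0 < s ->
  is_derive s 1 (fun t => (Num.sqrt t)^-1) (- 2^-1 * (Num.sqrt s)^-1 ^+ 3).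
Proof.
move=> s0; have ss : Num.sqrt s != 0 by rewrite gt_eqF // sqrtr_gt0.
have ds := is_derive1_sqrt s0.
apply: DeriveDef; first exact: derivableV.
rewrite deriveV // derive_val /GRing.scale /= invfM; field.
by rewrite ss.
Qed.

Lemma differentiable_invrho x : x != 0 -> differentiable (fun y => (rho y)^-1) x.
Proof.
move=> x0; have s0 : 0 < dotv x x by rewrite -sqr_rho exprn_gt0 // rho_gt0.
apply: (@differentiable_comp _ _ _ _ (fun y : 'rV[R]_n => dotv y y) (fun t => (Num.sqrt t)^-1)).
  exact: differentiable_dotv.
by apply/derivable1_diffP; have [] := is_derive_invsqrt s0.
Qed.

Lemma derive_invrho x v : x != 0 ->
  'D_v (fun y => (rho y)^-1) x = - dotv x v * (rho x)^-1 ^+ 3.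
Proof.
move=> x0; have s0 : 0 < dotv x x by rewrite -sqr_rho exprn_gt0 // rho_gt0.
rewrite deriveE; last exact: differentiable_invrho.
have dg : differentiable (fun t : R => (Num.sqrt t)^-1) (dotv x x).
  by apply/derivable1_diffP; have [] := is_derive_invsqrt s0.
have -> : (fun y => (rho y)^-1) = (fun t : R => (Num.sqrt t)^-1) \o (fun y : 'rV[R]_n => dotv y y) by [].
rewrite (diff_comp (@differentiable_dotv x) dg) /= diff1E // derive1E.
rewrite -deriveE; last exact: differentiable_dotv.
rewrite derive_dotv; have [_ ->] := is_derive_invsqrt s0.
by rewrite /GRing.scale /= -/(rho x); field; exact: rho_neq0.
Qed.

Lemma differentiable_dotvl (u x : 'rV[R]_n) : differentiable (fun y => dotv y u) x.
Proof.
have -> : (fun y => dotv y u) = \sum_i ((fun y : 'rV[R]_n => y 0 i) * cst (u 0 i)).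
  by apply/funext => y; rewrite dotvE fct_sumE.
apply: differentiable_sum => i; apply: differentiableM; last exact: differentiable_cst.
exact: differentiable_coord.
Qed.

Lemma derive_dotvl (u x v : 'rV[R]_n) : 'D_v (fun y => dotv y u) x = dotv v u.
Proof.
apply: cvg_lim => //; apply: (@cvg_trans _ (cst (dotv v u) @ (0 : R)^')); last exact: cvg_cst.
apply: near_eq_cvg; near=> h.
rewrite /= dotvDl dotvZl addrK /GRing.scale /= mulKf //.
by near: h; exact: nbhs_dnbhs_neq.
Unshelve. all: by end_near. Qed.

Lemma differentiable_reval a x : x != 0 -> differentiable (reval a) x.
Proof.
move=> x0; elim: a => [c|u||a da b db|a da b db] /=.
- exact: differentiable_cst.
- exact: differentiable_dotvl.
- exact: differentiable_invrho.
- exact: differentiableD.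
- exact: differentiableM.
Qed.

Lemma derive_reval a v x : x != 0 -> 'D_v (reval a) x = reval (rder v a) x.
Proof.
move=> x0; elim: a => [c|u||a da b db|a da b db] /=.
- by rewrite derive_cst.
- by rewrite derive_dotvl.
- by rewrite derive_invrho //; ring.
- rewrite -da -db -deriveD //; exact/diff_derivable/differentiable_reval.
- rewrite -da -db -[RHS]/(reval a x *: _ + _) [_ * reval b x]mulrC -deriveM //.
  + exact/diff_derivable/differentiable_reval.
  + exact/diff_derivable/differentiable_reval.
Qed.

Lemma near_neq0 x : x != 0 -> \forall y \near x, y != 0.
Proof.
move=> x0; apply/nbhs_ballP; exists `|x|; first by rewrite /= normr_gt0.
move=> y; rewrite -ball_normE /= => xy; apply/eqP => y0.
by move: xy; rewrite y0 subr0 ltxx.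
Qed.

Lemma derive2_reval a u v x : x != 0 ->
  'D_v ('D_u (reval a)) x = reval (rder v (rder u a)) x.
Proof.
move=> x0; rewrite -derive_reval //; apply: near_eq_derive.
by near=> y; rewrite derive_reval //; near: y; exact: near_neq0.
Unshelve. all: by end_near. Qed.

Lemma reval_derD a c u v x :
  reval (rder (c *: u + v) a) x = c * reval (rder u a) x + reval (rder v a) x.
Proof.
elim: a => [d|t||a da b db|a da b db] /=; rewrite ?dotvDr ?dotvZr ?dotvDl ?dotvZl;
  rewrite ?da ?db; ring.
Qed.

Lemma reval_der2D a c u v t x :
  reval (rder t (rder (c *: u + v) a)) x
    = c * reval (rder t (rder u a)) x + reval (rder t (rder v a)) x.
Proof.
elim: a => [d|e||a da b db|a da b db] /=; rewrite ?dotvDr ?dotvZr ?reval_derD ?da ?db; ring.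
Qed.

Lemma linear_sum_delta (F : 'rV[R]_n -> R) :
  (forall c u v, F (c *: u + v) = c * F u + F v) ->
  forall v, \sum_i v 0 i * F (delta_mx 0 i) = F v.
Proof.
move=> linF v; have F0 : F 0 = 0.
  by have := linF 1 0 0; rewrite scaler0 addr0 mul1r => /eqP; rewrite -subr_eq subrr eq_sym => /eqP.
rewrite [in RHS](row_sum_delta v).
by elim/big_ind2 : _ => [//|s1 t1 s2 t2 -> ->|i _]; [rewrite -[s1 in RHS]scale1r linF mul1r|rewrite -[_ *: _ in RHS]addr0 linF F0 addr0].
Qed.

Lemma bil_hessian_reval a v x : x != 0 ->
  bil (hessian (reval a) x) v v = reval (rder v (rder v a)) x.
Proof.
move=> x0.
rewrite -(linear_sum_delta (F := fun u => reval (rder v (rder u a)) x)); last first.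
  by move=> c s t; rewrite reval_der2D.
transitivity (\sum_i \sum_j v 0 i * (v 0 j * reval (rder (delta_mx 0 j) (rder (delta_mx 0 i) a)) x)).
  rewrite /bil mxE exchange_big /=; apply: eq_bigr => j _.
  rewrite !mxE mulr_suml; apply: eq_bigr => i _.
  by rewrite !mxE /partial derive2_reval // mulrAC mulrA.
apply: eq_bigr => i _; rewrite -mulr_sumr.
rewrite (linear_sum_delta (F := fun u => reval (rder u (rder (delta_mx 0 i) a)) x)) //.
by move=> c s t; rewrite reval_derD.
Qed.

Lemma sqr_dotv_le u v : dotv u v ^+ 2 <= dotv u u * dotv v v.
Proof.
have [->|v0] := eqVneq v 0.
  by rewrite /dotv trmx0 !mulmx0 mxE expr0n mulr0.
have vv : 0 < dotv v v by rewrite lt_def dotv_eq0 v0 dotv_ge0.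
have := dotv_ge0 (dotv v v *: u - dotv u v *: v).
rewrite !(dotvDl, dotvNl, dotvDr, dotvNr, dotvZl, dotvZr) (dotvC v u) => H.
rewrite -(ler_pM2l vv); nra.
Qed.

Lemma dotv_le_rho u v : `|dotv u v| <= rho u * rho v.
Proof.
rewrite -(@ler_pXn2r _ 2) ?nnegrE ?mulr_ge0 ?sqrtr_ge0 //.
by rewrite real_normK ?num_real // exprMn !sqr_rho sqr_dotv_le.
Qed.

Lemma rhoZ t x : 0 < t -> rho (t *: x) = t * rho x.
Proof.
move=> t0; rewrite /rho dotvZl dotvZr mulrA -expr2 sqrtrM ?sqr_ge0 //.
by rewrite sqrtr_sqr gtr0_norm.
Qed.

Lemma rhom_der a k v : rhom a k -> rhom (rder v a) (k - 1).
Proof.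
elim => {a k} [k|c|u||a b k _ ha _ hb|a b k l p ha ia hb ib <-] /=.
- exact: rhom_cst0.
- exact: rhom_cst0.
- by rewrite subrr; exact: rhom_cst.
- apply: (@rhom_mul _ _ 1 (-3)) => //; last first.
    by apply: (rhom_mul rhom_inv (rhom_mul rhom_inv rhom_inv erefl)).
  by apply: (rhom_mul (rhom_cst _) (rhom_lin _)).
- exact: rhom_add.
- apply: rhom_add; first by apply: (rhom_mul ha ib); rewrite addrA.
  by apply: (rhom_mul ia hb); rewrite addrAC.
Qed.

Lemma rhom_bound a k : rhom a k ->
  exists2 K : R, 0 <= K & forall x, x != 0 -> `|reval a x| <= K * rho x ^ k.
Proof.
elim => {a k} [k|c|u||a b k _ [K K0 aK] _ [L L0 bL]|a b k l p _ [K K0 aK] _ [L L0 bL] <-] /=.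
- by exists 0 => // x _; rewrite normr0 mul0r.
- by exists `|c| => // x _; rewrite expr0z mulr1.
- by exists (rho u) => [|x _]; rewrite ?sqrtr_ge0 // expr1z mulrC dotv_le_rho.
- exists 1 => // x x0; rewrite mul1r ger0_norm ?invr_ge0 ?sqrtr_ge0 //.
- exists (K + L) => [|x x0]; first exact: addr_ge0.
  by rewrite mulrDl (le_trans (ler_normD _ _)) // lerD ?aK ?bL.
- exists (K * L) => [|x x0]; first exact: mulr_ge0.
  by rewrite normrM expfzDr ?rho_neq0 // mulrACA ler_pM ?aK ?bL.
Qed.

(** Valid at the origin as well, where the inverse norm evaluates to [0]. *)
Lemma rhom_scale a k t x : rhom a k -> 0 < t -> reval a (t *: x) = t ^ k * reval a x.
Proof.
move=> ak t0; elim: ak => {a k} [k|c|u||a b k _ IHa _ IHb|a b k l p _ IHa _ IHb <-] /=.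
- by rewrite mulr0.
- by rewrite expr0z mul1r.
- by rewrite dotvZl.
- by rewrite rhoZ // invfM.
- by rewrite IHa IHb mulrDr.
- by rewrite IHa IHb expfzDr ?gt_eqF // mulrACA.
Qed.

Lemma rhom_reval0 a k : rhom a k -> 0 < k -> reval a 0 = 0.
Proof.
move=> ak k0; have := rhom_scale 0 ak (ltr0n R 2); rewrite scaler0.
case: k k0 ak => // -[//|k] _ _; rewrite -exprnP => /eqP.
rewrite -subr_eq0 -{1}[reval a 0]mul1r -mulrBl mulf_eq0 => /orP[|/eqP//].
have : 1 < (2 : R) ^+ k.+1 by rewrite exprn_egt1 ?ltr1n.
by rewrite subr_eq0 => /[swap] /eqP <-; rewrite ltxx.
Qed.

Definition rsum (s : seq rexpr) : rexpr := foldr RAdd (RCst 0) s.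

Lemma reval_rsum I (s : seq I) (F : I -> rexpr) x :
  reval (rsum [seq F i | i <- s]) x = \sum_(i <- s) reval (F i) x.
Proof. by elim: s => [|i s IH] /=; rewrite ?big_nil // big_cons IH. Qed.

Lemma rder_rsum I (s : seq I) (F : I -> rexpr) v :
  rder v (rsum [seq F i | i <- s]) = rsum [seq rder v (F i) | i <- s].
Proof. by elim: s => [|i s IH] //=; rewrite IH. Qed.

Lemma rhom_rsum I (s : seq I) (F : I -> rexpr) k :
  (forall i, rhom (F i) k) -> rhom (rsum [seq F i | i <- s]) k.
Proof. by move=> Fk; elim: s => [|i s IH] /=; [exact: rhom_cst0|exact: rhom_add]. Qed.

End Radial.

(** * Eigenvectors, and the gap between two Hessians *)

Section Eigen.
Context {R : realType} {n : nat}.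
Implicit Types (u v g : 'rV[R]_n) (C : 'M[R]_n).

Lemma continuous_dotvl u : continuous (fun x : 'rV[R]_n => dotv x u).
Proof. by move=> x; apply/differentiable_continuous/differentiable_dotvl. Qed.

Lemma continuous_dotv : continuous (fun x : 'rV[R]_n => dotv x x).
Proof. by move=> x; apply/differentiable_continuous/differentiable_dotv. Qed.

Lemma continuous_bil C : continuous (fun x : 'rV[R]_n => bil C x x).
Proof.
have -> : (fun x => bil C x x)
    = \sum_j ((fun x => dotv x (col j C)^T) * (fun x : 'rV[R]_n => x 0 j)).
  apply/funext => x; rewrite fct_sumE bil_dotv dotvE; apply: eq_bigr => j _.
  congr (_ * _); rewrite mxE dotvE; apply: eq_bigr => i _; by rewrite !mxE.
move=> x; apply/differentiable_continuous; apply: differentiable_sum => j.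
by apply: differentiableM; [exact: differentiable_dotvl|exact: differentiable_coord].
Qed.

Lemma normr_le_rho u : `|u| <= rho u.
Proof.
rewrite /Num.norm /= mx_normrE; apply/bigmax_leP; split=> [|[i j] _ /=]; first exact: sqrtr_ge0.
rewrite ord1 -(@ler_pXn2r _ 2) ?nnegrE ?sqrtr_ge0 ?normr_ge0 //.
rewrite sqr_rho real_normK ?num_real // dotvE (bigD1 j) //= expr2 lerDl.
by rewrite sumr_ge0 // => k _; rewrite -expr2 sqr_ge0.
Qed.

Lemma compact_sphere_perp g : compact [set u : 'rV[R]_n | dotv u u = 1 /\ dotv u g = 0].
Proof.
apply: bounded_closed_compact.
  exists 1; split; first exact: num_real.
  move=> M M1 u [uu _]; apply: le_trans (normr_le_rho u) _.
  by rewrite /rho uu sqrtr1 ltW.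
have -> : [set u : 'rV[R]_n | dotv u u = 1 /\ dotv u g = 0]
    = (fun u => dotv u u) @^-1` [set x | x = 1] `&` (fun u => dotv u g) @^-1` [set x | x = 0].
  by apply/seteqP; split.
apply: closedI; apply: closed_comp.
- by move=> u _; exact: continuous_dotv.
- exact: closed_eq.
- by move=> u _; exact: continuous_dotvl.
- exact: closed_eq.
Qed.

(** The quadratic form of [C] is maximized over the unit vectors orthogonal to
    a known eigenvector [g]; a maximizer is an eigenvector, as otherwise moving
    it along its residual would increase the form. With [g = 0] this produces
    the largest eigenvalue. *)
Lemma exists_eigenvector C g mu : C^T = C -> g *m C = mu *: g ->
  (exists2 u, u != 0 & dotv u g = 0) ->
  exists e lam, [/\ dotv e e = 1, dotv e g = 0, e *m C = lam *: e &
    forall u, dotv u g = 0 -> bil C u u <= lam * dotv u u].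
Proof.
move=> sC gC [u0 u00 u0g].
pose K := [set u : 'rV[R]_n | dotv u u = 1 /\ dotv u g = 0].
have [||e] := @EVT_max_rV R n (fun u => bil C u u) K _ (@compact_sphere_perp g).
- exists (unitv u0); split; first exact: dotv_unitv.
  by rewrite dotvZl u0g mulr0.
- exact/continuous_subspaceT/continuous_bil.
rewrite inE => -[ee eg] emax; exists e, (bil C e e).
have maxe u : dotv u g = 0 -> bil C u u <= bil C e e * dotv u u.
  move=> ug; have [->|un0] := eqVneq u 0; first by rewrite /bil /dotv !mul0mx mxE mulr0.
  have : bil C (unitv u) (unitv u) <= bil C e e.
    by apply: emax; rewrite inE; split; [exact: dotv_unitv|rewrite dotvZl ug mulr0].
  by rewrite bil_unitv ler_pdivrMr // -sqr_rho exprn_gt0 // rho_gt0.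
split=> //; apply/eqP; rewrite -subr_eq0 -dotv_eq0; set lam := bil C e e.
set z := _ - _.
have zg : dotv z g = 0.
  by rewrite dotvDl dotvNl dotvZl eg mulr0 subr0 -bil_dotv bilC // bil_dotv gC dotvZl dotvC eg mulr0.
have ez : dotv e z = 0.
  by rewrite dotvDr dotvNr dotvZr ee mulr1 dotvC -bil_dotv subrr.
have Cez : bil C e z = dotv z z.
  rewrite bil_dotv (_ : e *m C = z + lam *: e); last by rewrite subrK.
  by rewrite dotvDl dotvZl ez mulr0 addr0.
set dd := dotv z z in Cez *; have dd0 : 0 <= dd := dotv_ge0 z.
(* with this t the first-order gain - 2 t dd beats the second-order loss t^2 c *)
pose c := `|lam * dd - bil C z z|.
have c0 : 0 <= c := normr_ge0 _.
pose t := - (dd / (1 + c)).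
have := maxe (e - t *: z).
have -> : dotv (e - t *: z) g = 0 by rewrite dotvDl dotvNl dotvZl eg zg mulr0 subr0.
move=> /(_ erefl); rewrite -bil1M bil_subZ [X in _ <= _ * X]bil_subZ !bil1M (bilC z e sC) Cez (dotvC z e) ez ee -/lam -/dd => H.
have {}H : - 2 * t * dd <= t ^+ 2 * (lam * dd - bil C z z) by move: H; lra.
have {}H : - 2 * t * dd <= t ^+ 2 * c.
  by apply: le_trans H _; rewrite ler_wpM2l ?sqr_ge0 ?ler_norm.
have c1 : 0 < 1 + c by rewrite ltr_wpDr.
have {}H : 2 * dd ^+ 2 * (1 + c) <= dd ^+ 2 * c.
  have -> : 2 * dd ^+ 2 * (1 + c) = - 2 * t * dd * (1 + c) ^+ 2.
    by rewrite /t; field; rewrite gt_eqF.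
  have -> : dd ^+ 2 * c = t ^+ 2 * c * (1 + c) ^+ 2.
    by rewrite /t; field; rewrite gt_eqF.
  by rewrite ler_wpM2r ?sqr_ge0.
have : 0 <= dd ^+ 2 * c by rewrite mulr_ge0 ?sqr_ge0.
have := sqr_ge0 dd => s0 s1.
by rewrite -sqrf_eq0; apply/eqP; lra.
Qed.

Lemma exists_perp g : (1 < n)%N -> exists2 u : 'rV[R]_n, u != 0 & dotv u g = 0.
Proof.
move=> n1; pose i := Ordinal (ltnW n1); pose j := Ordinal n1.
have ij : i != j by [].
have [gi|gi] := eqVneq (g 0 i) 0.
  exists (delta_mx 0 i); last by rewrite dotv_delta.
  by apply/eqP => /rowP/(_ i)/eqP; rewrite !mxE !eqxx oner_eq0.
exists (g 0 i *: delta_mx 0 j - g 0 j *: delta_mx 0 i).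
  apply/eqP => /rowP/(_ j)/eqP; rewrite !mxE !eqxx [j == i]eq_sym (negbTE ij) !mulr0 mulr1 subr0.
  by rewrite (negbTE gi).
by rewrite dotvDl dotvNl !dotvZl !dotv_delta mulrC subrr.
Qed.

(** If [A - B] takes a positive value orthogonally to its top eigenvector [e],
    its second eigenvalue is positive and [second_eigenvalue_npos] applies.
    Otherwise [not_npos_off_top] applies, with [f] chosen so that [e (A + B)]
    lies in the plane of [e] and [f]. *)
Lemma hess_gap (A B : 'M[R]_n) : (3 <= n)%N -> A^T = A -> B^T = B ->
  \tr A = 0 -> \tr B = 0 -> \tr (A *m A) = 1 -> \tr (B *m B) = 1 ->
  let dl := \tr (A *m A *m A) - \tr (B *m B *m B) in
  0 < dl ->
  exists V : 'M[R]_n, [/\ V^T = V, \tr V = 0 &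
    dl / (n%:R + 3) * \tr (V *m V) < hessW A V - hessW B V].
Proof.
move=> n3 sA sB tA tB nA nB dl dl0; apply: contrapT => noV.
have n3' : 3 <= n%:R :> R by rewrite ler_nat.
pose eta : R := 1 / (n%:R + 3).
have eta0 : 0 <= eta by rewrite divr_ge0 // addr_ge0.
have eta6 : eta <= 1 / 6 by rewrite ler_pM2l // lef_pV2 ?posrE //; lra.
have small (V : 'M[R]_n) : V^T = V -> \tr V = 0 ->
    hessW A V - hessW B V <= eta * dl * \tr (V *m V).
  move=> sV tV; rewrite leNgt; apply/negP => H; apply: noV; exists V; split => //.
  by apply: le_lt_trans H; rewrite /eta mul1r [_^-1 * _]mulrC.
pose c : R := (1 + \tr (A *m B)) / 2.
have BA : \tr (B *m A) = \tr (A *m B) by rewrite mxtrace_mulC.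
have SS : \tr ((A + B) *m (A + B)) = 4 * c.
  by rewrite mulmxDl !mulmxDr !mxtraceD nA nB BA /c; field.
have CC : \tr ((A - B) *m (A - B)) = 4 * (1 - c).
  by rewrite mxtrace_sqrB nA nB /c; field.
have SC : \tr ((A - B) *m (A + B)) = 0.
  by rewrite mulmxBl !mulmxDr mxtraceB !mxtraceD nA nB BA; ring.
have tS : \tr (A + B) = 0 by rewrite mxtraceD tA tB addr0.
have tC : \tr (A - B) = 0 by rewrite mxtraceB tA tB subr0.
have sC : (A - B)^T = A - B by rewrite linearB /= sA sB.
have n1 : (1 < n)%N by apply: leq_trans n3.
have [||e [lam [ee _ eC lame]]] := @exists_eigenvector (A - B) 0 0 sC.
- by rewrite mul0mx scale0r.
- have [u u0 _] := exists_perp 0 n1; exists u => //.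
  by rewrite /dotv trmx0 mulmx0 mxE.
have {}lame u : bil (A - B) u u <= lam * dotv u u.
  by apply: lame; rewrite /dotv trmx0 mulmx0 mxE.
have [C0|] := pselect (forall u, dotv u e = 0 -> bil (A - B) u u <= 0); last first.
  move=> /existsNP[u /not_implyP[ue /negP]]; rewrite -ltNge => Cu.
  have u0 : u != 0.
    by apply: contraTneq Cu => ->; rewrite /bil !mul0mx mxE ltxx.
  have [|f [lam2 [ff fe fC lam2f]]] := exists_eigenvector sC eC; first by exists u.
  have l2 := second_eigenvalue_npos erefl erefl erefl sA sB dl0 eta0 eta6 small
    SS CC SC tS tC ee eC lame (lexx _) n1 ff (etrans (dotvC _ _) fe) fC lam2f.
  have := lam2f u ue; rewrite leNgt => /negP; apply.
  by apply: le_lt_trans Cu; rewrite mulr_le0_ge0 // dotv_ge0.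
pose s1 := bil (A + B) e e; pose y := e *m (A + B) - s1 *: e.
have ye : dotv y e = 0 by rewrite dotvDl dotvNl dotvZl ee mulr1 subrr.
have [f [ff ef Se]] : exists f, [/\ dotv f f = 1, dotv e f = 0 &
    e *m (A + B) = s1 *: e + bil (A + B) e f *: f].
  have eSy : e *m (A + B) = s1 *: e + y by rewrite [RHS]addrC subrK.
  have [y0|y0] := eqVneq y 0.
    have [u u0 ue] := exists_perp e n1; exists (unitv u).
    have eu : dotv e (unitv u) = 0 by rewrite dotvZr dotvC ue mulr0.
    split=> //; first exact: dotv_unitv.
    by rewrite bil_dotv eSy y0 addr0 dotvZl eu mulr0 scale0r addr0.
  exists (unitv y); have ey : dotv e (unitv y) = 0 by rewrite dotvZr dotvC ye mulr0.
  split=> //; first exact: dotv_unitv.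
  rewrite bil_dotv eSy dotvDl dotvZl ey mulr0 add0r dotvZr -sqr_rho expr2 mulKf ?rho_neq0 //.
  by rewrite scalerA mulfV ?rho_neq0 // scale1r.
exact: (not_npos_off_top erefl erefl erefl sA sB dl0 eta0 eta6 small
    SS CC SC tC ee eC lame n3 ff ef Se C0).
Qed.

End Eigen.

(** * The function in coordinates and its Hessian *)

Lemma symmetricmxP (R : realType) n (X : 'M[R]_n) : (X \is symmetricmx) <-> X^T = X.
Proof.
by split=> [/is_hermitianmxP|] H; [|apply/is_hermitianmxP];
  move: H; rewrite expr0 scale1r map_mx_id.
Qed.

Section Coordinates.
Context {R : realType} {m d : nat}.
Variable E : 'I_d -> 'M[R]_m.
Implicit Types (x y v : 'rV[R]_d).

Local Notation X := (from_coords E).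

Definition entry k l : 'rV[R]_d := \row_i E i k l.

Lemma from_coordsE x k l : X x k l = dotv x (entry k l).
Proof. by rewrite /from_coords summxE dotvE; apply: eq_bigr => i _; rewrite !mxE. Qed.

Lemma from_coordsZ a x : X (a *: x) = a *: X x.
Proof. by apply/matrixP => k l; rewrite mxE !from_coordsE dotvZl. Qed.

Lemma from_coords_delta i : X (delta_mx 0 i) = E i.
Proof.
by apply/matrixP => k l; rewrite from_coordsE dotv_delta mxE.
Qed.

Lemma mxtrace3E (A B C : 'M[R]_m) : \tr (A *m B *m C) =
  \sum_(t : 'I_m * 'I_m * 'I_m) A t.1.1 t.1.2 * B t.1.2 t.2 * C t.2 t.1.1.
Proof.
rewrite -(pair_bigA _ (fun q p => A q.1 q.2 * B q.2 p * C p q.1)) /=.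
rewrite -(pair_bigA _ (fun k l => \sum_p A k l * B l p * C p k)) /=.
apply: eq_bigr => k _; rewrite mxE exchange_big /=; apply: eq_bigr => p _.
by rewrite !mxE mulr_suml.
Qed.

Definition cubic : rexpr :=
  rsum [seq RMul (RMul (RLin (entry t.1.1 t.1.2)) (RLin (entry t.1.2 t.2)))
                 (RLin (entry t.2 t.1.1)) | t <- index_enum ('I_m * 'I_m * 'I_m)%type].

Definition wexpr : rexpr := RMul cubic RInvNorm.

Lemma rhom_wexpr : rhom wexpr 2.
Proof.
apply: (@rhom_mul _ _ _ _ 3 (-1)) => //; last exact: rhom_inv.
apply: rhom_rsum => t.
by apply: (rhom_mul (rhom_mul (rhom_lin _) (rhom_lin _) erefl) (rhom_lin _)).
Qed.

Lemma reval_cubic x : reval cubic x = \tr (X x *m X x *m X x).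
Proof.
by rewrite reval_rsum mxtrace3E; apply: eq_bigr => t _ /=; rewrite !from_coordsE.
Qed.

Lemma reval_der_cubic v x : reval (rder v cubic) x = 3 * \tr (X x *m X x *m X v).
Proof.
have -> : 3 * \tr (X x *m X x *m X v)
    = \tr (X x *m X x *m X v) + (\tr (X x *m X v *m X x) + \tr (X v *m X x *m X x)).
  have -> : \tr (X x *m X v *m X x) = \tr (X x *m X x *m X v).
    by rewrite mxtrace_mulC mulmxA.
  have -> : \tr (X v *m X x *m X x) = \tr (X x *m X x *m X v).
    by rewrite -mulmxA mxtrace_mulC.
  ring.
rewrite rder_rsum reval_rsum !mxtrace3E -!big_split; apply: eq_bigr => t _ /=.
by rewrite !from_coordsE; ring.
Qed.

Lemma reval_der2_cubic v x :
  reval (rder v (rder v cubic)) x = 6 * \tr (X x *m (X v *m X v)).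
Proof.
have -> : 6 * \tr (X x *m (X v *m X v))
    = 2 * \tr (X x *m X v *m X v) + (2 * \tr (X v *m X x *m X v) + 2 * \tr (X v *m X v *m X x)).
  have -> : \tr (X v *m X x *m X v) = \tr (X x *m X v *m X v).
    by rewrite -mulmxA mxtrace_mulC.
  have -> : \tr (X v *m X v *m X x) = \tr (X x *m X v *m X v).
    by rewrite mxtrace_mulC mulmxA.
  by rewrite mulmxA; ring.
rewrite !rder_rsum reval_rsum !mxtrace3E !mulr_sumr -!big_split; apply: eq_bigr => t _ /=.
by rewrite !from_coordsE; ring.
Qed.

Hypothesis onE : orthonormal_basis_Sym0 E.

Lemma trmx_from_coords x : (X x)^T = X x.
Proof.
have [sE _ _] := onE; apply/matrixP => k l; rewrite mxE !from_coordsE.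
congr (dotv x _); apply/rowP => i; rewrite !mxE.
by have [/symmetricmxP sEi _] := sE i; rewrite -[in LHS]sEi mxE.
Qed.

Lemma mxtrace_from_coords x : \tr (X x) = 0.
Proof.
have [sE _ _] := onE; rewrite /from_coords raddf_sum big1 // => i _.
by have [_ tEi] := sE i; rewrite /= mxtraceZ tEi mulr0.
Qed.

Lemma mxtrace_from_coordsM x y : \tr (X x *m X y) = dotv x y.
Proof.
have [_ oE _] := onE; rewrite /from_coords mulmx_suml raddf_sum dotvE.
apply: eq_bigr => i _ /=; rewrite -scalemxAl mulmx_sumr mxtraceZ raddf_sum /=.
rewrite (bigD1 i) //= big1 ?addr0 => [|j ji].
  by rewrite -scalemxAr mxtraceZ [\tr _](oE i i) eqxx mulr1.
by rewrite -scalemxAr mxtraceZ [\tr _](oE i j) eq_sym (negbTE ji) mulr0.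
Qed.

Lemma frob_norm_from_coords x : frob_norm (X x) = rho x.
Proof. by rewrite /frob_norm expr2 -mulmxE mxtrace_from_coordsM. Qed.

Lemma w_reval : w E = reval wexpr.
Proof.
apply/funext => x; rewrite /w /W /= reval_cubic frob_norm_from_coords.
case: eqP => [->|_]; first by rewrite !mul0mx mxtrace0 mul0r.
by rewrite !exprS expr0 mulr1 -!mulmxE mulmxA.
Qed.

Lemma bil_hessian_w x v : x != 0 ->
  bil (hessian (w E) x) v v = hessW (X (unitv x)) (X v).
Proof.
move=> x0; rewrite w_reval bil_hessian_reval //.
rewrite /hessW /unitv from_coordsZ.
rewrite -!scalemxAl -!scalemxAr -!scalemxAl !mxtraceZ !mxtrace_from_coordsM.
rewrite -[RHS]addr0.
rewrite /wexpr [rder v (RMul _ _)]/= [rder v _]/= [reval _ x]/=.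
rewrite reval_cubic reval_der_cubic reval_der2_cubic.
move: (rho x)^-1 => r; ring.
Qed.

Lemma from_coords_onto V : V^T = V -> \tr V = 0 -> exists v, V = X v.
Proof. by have [_ _ ontoE] := onE => sV tV; apply: ontoE; split=> //; apply/symmetricmxP. Qed.

(** By completeness of the basis, [E] may be eliminated: [sum_i (E i)_ac (E i)_cb]
    is an entry of the projection of an elementary symmetric matrix onto the
    traceless ones. *)
Lemma sum_sqr_basis : (0 < m)%N ->
  \sum_i E i *m E i = ((1 + m%:R) / 2 - m%:R^-1)%:M.
Proof.
move=> m0; have mn0 : m%:R != 0 :> R by rewrite pnatr_eq0 -lt0n.
pose U a b : 'M[R]_m := 2^-1 *: (delta_mx a b + delta_mx b a).
(* the traceless part of the elementary symmetric matrix U a b *)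
pose P a b : 'M[R]_m := U a b - ((a == b)%:R / m%:R)%:M.
have sP a b : (P a b)^T = P a b.
  apply/matrixP => k l; rewrite !mxE [l == k]eq_sym.
  by rewrite [(l == a) && _]andbC [(l == b) && _]andbC; ring.
have trU (Z : 'M[R]_m) a b : Z^T = Z -> \tr (Z *m U a b) = Z a b.
  move=> sZ; rewrite -scalemxAr mxtraceZ mulmxDr mxtraceD.
  have t c e : \tr (Z *m delta_mx c e) = Z e c.
    rewrite /mxtrace (bigD1 e) //= big1 ?addr0 => [|i ie].
      rewrite mxE (bigD1 c) //= big1 ?addr0 ?mxE ?eqxx ?mulr1 // => j jc.
      by rewrite mxE (negbTE jc) mulr0.
    by rewrite mxE big1 // => j _; rewrite mxE (negbTE ie) andbF mulr0.
  by rewrite !t -[in Z b a]sZ mxE; field.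
have trP a b : \tr (P a b) = 0.
  rewrite mxtraceB mxtrace_scalar -[U a b]mul1mx trU ?trmx1 // mxE.
  by rewrite -[_ / _ *+ _]mulr_natr divfK // subrr.
have trEP (Z : 'M[R]_m) a b : Z^T = Z -> \tr Z = 0 -> \tr (Z *m P a b) = Z a b.
  by move=> sZ tZ; rewrite mulmxBr mxtraceB trU // mul_mx_scalar mxtraceZ tZ mulr0 subr0.
have sE i : (E i)^T = E i by have [/(_ i)[/symmetricmxP]] := onE.
have tE i : \tr (E i) = 0 by have [/(_ i)[]] := onE.
have PE a b c : \sum_i E i a c * E i c b = P a c c b.
  have [y Py] := from_coords_onto (sP a c) (trP a c).
  have [z Pz] := from_coords_onto (sP c b) (trP c b).
  rewrite -trEP // {1}Py Pz mxtrace_from_coordsM dotvE; apply: eq_bigr => i _.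
  rewrite -(trEP (E i)) // -(trEP (E i) c b) // Py Pz -!(from_coords_delta i).
  by rewrite !mxtrace_from_coordsM !dotv_delta.
apply/matrixP => a b; rewrite summxE.
transitivity (\sum_c P a c c b).
  under [RHS]eq_bigr do rewrite -PE.
  by rewrite exchange_big /=; apply: eq_bigr => i _; rewrite mxE.
under eq_bigr do rewrite !mxE.
rewrite big_split /= -mulr_sumr big_split /=.
have -> : \sum_(i < m) ((i == a) && (b == i))%:R = (a == b)%:R :> R.
  rewrite (bigD1 a) //= eqxx big1 ?addr0 1?eq_sym // => i ia.
  by rewrite (negbTE ia).
have -> : \sum_(i < m) ((i == i) && (b == a))%:R = m%:R * (a == b)%:R :> R.
  under eq_bigr do rewrite eqxx /= eq_sym.
  by rewrite sumr_const card_ord mulr_natl.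
have -> : \sum_(i < m) ((a == i)%:R / m%:R *- (i == b)) = - ((a == b)%:R / m%:R) :> R.
  rewrite (bigD1 a) //= eqxx big1 ?addr0 => [|i ia].
    by case: eqP => _; rewrite ?mulr1n ?mulr0n // mul0r.
  by rewrite eq_sym (negbTE ia) mul0r mul0rn oppr0.
by rewrite mxE; case: eqP => _; rewrite ?mulr1n ?mulr0n; [field|ring].
Qed.

(** Summed over the basis, the first term of [hessW] vanishes, being a multiple
    of the trace of [A] by [sum_sqr_basis]; the other three give
    [(- 6 + 3 - d) tr(A^3)]. *)
Lemma mxtrace_hessian_w x : (0 < m)%N -> x != 0 ->
  let A := X (unitv x) in
  \tr (hessian (w E) x) = - (d%:R + 3) * \tr (A *m A *m A).
Proof.
move=> m0 x0 /=; have aa := dotv_unitv x0; set a := unitv x in aa *; set A := X a.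
have -> : \tr (hessian (w E) x) = \sum_i hessW A (E i).
  apply: eq_bigr => i _; rewrite -from_coords_delta -bil_hessian_w //.
  by rewrite bil_dotv -rowE dotvC dotv_delta [RHS]mxE.
have AE i : \tr (A *m E i) = a 0 i.
  by rewrite /A -from_coords_delta mxtrace_from_coordsM dotvC dotv_delta.
have lin (B : 'M[R]_m) : \tr (B *m A) = \sum_i a 0 i * \tr (B *m E i).
  rewrite /A /from_coords mulmx_sumr raddf_sum; apply: eq_bigr => i _ /=.
  by rewrite -scalemxAr mxtraceZ.
have EE i : \tr (E i *m E i) = 1 by have [_ /(_ i i)] := onE; rewrite eqxx.
rewrite /hessW !(big_split, sumrN) /=.
have -> : \sum_i 6 * \tr (A *m (E i *m E i)) = 0.
  rewrite -mulr_sumr.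
  have -> : \sum_i \tr (A *m (E i *m E i)) = \tr (A *m \sum_i E i *m E i).
    by rewrite mulmx_sumr raddf_sum.
  by rewrite sum_sqr_basis // mul_mx_scalar mxtraceZ mxtrace_from_coords !mulr0.
have -> : \sum_i 6 * \tr (A *m A *m E i) * \tr (A *m E i) = 6 * \tr (A *m A *m A).
  by rewrite [in RHS]lin mulr_sumr; apply: eq_bigr => i _; rewrite AE; ring.
have -> : \sum_i 3 * \tr (A *m A *m A) * \tr (A *m E i) ^+ 2 = 3 * \tr (A *m A *m A).
  rewrite -mulr_sumr -[RHS]mulr1 -aa dotvE; congr (_ * _).
  by apply: eq_bigr => i _; rewrite AE expr2.
have -> : \sum_i \tr (A *m A *m A) * \tr (E i *m E i) = d%:R * \tr (A *m A *m A).
  under eq_bigr do rewrite EE mulr1.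
  by rewrite sumr_const card_ord mulr_natl.
ring.
Qed.
End Coordinates.

(** * Second-order contact of functions *)

Section OneVariable.
Context {R : realType}.
Implicit Types (f g : R -> R).

Lemma right_neg f (l : R) : is_derive (0 : R) (1 : R) f l -> f 0 = 0 -> l < 0 ->
  \forall t \near (0 : R)^'+, f t < 0.
Proof.
move=> [df fl] f0 l0.
have fcvg : (fun h => h^-1 *: ((f \o shift 0) (h *: 1) - f 0)) @ (0 : R)^' --> l.
  by rewrite -fl.
have : \forall h \near (0 : R)^', h^-1 *: ((f \o shift 0) (h *: 1) - f 0) < 0.
  by have := cvgr_lt _ fcvg; apply.
move=> /nbhs_ballP [e /= e0 he]; near=> t.
have t0 : 0 < t by near: t; exact: nbhs_right_gt.
have te : t < e by near: t; exact: nbhs_right_lt.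
have := he t; rewrite /ball /= sub0r normrN gtr0_norm // => /(_ te (lt0r_neq0 t0)).
by rewrite f0 subr0 addr0 /GRing.scale /= mulr1 pmulr_rlt0 ?invr_gt0.
Unshelve. all: by end_near. Qed.

Lemma right_derive_ge0 f (l : R) : is_derive (0 : R) (1 : R) f l -> f 0 = 0 ->
  (\forall t \near (0 : R)^'+, 0 <= f t) -> 0 <= l.
Proof.
move=> df f0 fpos; rewrite leNgt; apply/negP => /(right_neg df f0) fneg.
near (0 : R)^'+ => t.
have t0 : 0 <= f t by near: t.
have : f t < 0 by near: t.
by rewrite ltNge t0.
Unshelve. all: by end_near. Qed.

(** Positivity is assumed on one side only, as this is what homogeneity
    provides in [contact_origin]. *)
Lemma right_derive2_ge0 g (g1 : R -> R) (g2 : R) :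
  (\forall t \near (0 : R), is_derive t (1 : R) g (g1 t)) ->
  is_derive (0 : R) (1 : R) g1 g2 -> g 0 = 0 -> g1 0 = 0 ->
  (\forall t \near (0 : R)^'+, 0 <= g t) -> 0 <= g2.
Proof.
move=> /nbhs_ballP[e /= e0 dg] dg1 g0 g10 /nbhs_ballP[a /= a0 gpos].
rewrite leNgt; apply/negP => /(right_neg dg1 g10) /nbhs_ballP[b /= b0 g1neg].
pose t := Num.min e (Num.min a b) / 2.
have m0 : 0 < Num.min e (Num.min a b) by rewrite !lt_min e0 a0.
have t0 : 0 < t by rewrite divr_gt0.
have [te ta tb] : [/\ t < e, t < a & t < b].
  have : t < Num.min e (Num.min a b) by rewrite /t ltr_pdivrMr // ltr_pMr // ltr1n.
  by rewrite !lt_min => /and3P[].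
have B (r s : R) : 0 < s -> s < r -> ball (0 : R) r s.
  by move=> s0 sr; rewrite /ball /= sub0r normrN gtr0_norm.
have [c|x|c] := @MVT R g g1 0 t t0.
- rewrite in_itv /= => /andP[c0 ct]; apply: dg; apply: B => //; exact: lt_trans te.
- apply: continuous_in_subspaceT => {}x; rewrite inE /= in_itv /= => /andP[x0 xt].
  have : ball (0 : R) e x.
    by rewrite /ball /= sub0r normrN ger0_norm //; exact: le_lt_trans te.
  by move=> /dg[dgx _]; apply/differentiable_continuous/derivable1_diffP.
rewrite in_itv /= => /andP[c0 ct]; rewrite g0 !subr0 => gt.
have gt0 : 0 <= g t by apply: gpos => //; exact: B.
have : g1 c < 0 by apply: g1neg => //; apply: B => //; exact: lt_trans tb.
by move=> g1c; move: gt0; rewrite gt leNgt nmulr_rlt0 // t0.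
Qed.
End OneVariable.

Section Lines.
Context {R : realType} {n : nat}.
Implicit Types (x y v : 'rV[R]_n) (f : 'rV[R]_n -> R).

Lemma near_line (P : set 'rV[R]_n) x v : (\forall y \near x, P y) ->
  \forall t \near (0 : R), P (x + t *: v).
Proof.
have : (fun t : R => x + t *: v) @ (0 : R) --> x + (0 : R) *: v.
  by apply: cvgD; [exact: cvg_cst|apply: cvgZr_tmp; exact: cvg_id].
by rewrite scale0r addr0; apply.
Qed.

Lemma is_derive_line f x v (t : R) : differentiable f (x + t *: v) ->
  is_derive t (1 : R) (fun s => f (x + s *: v)) ('D_v f (x + t *: v)).
Proof.
move=> df.
have E : (fun h : R => h^-1 *: (((fun s => f (x + s *: v)) \o shift t) (h *: 1) - f (x + t *: v)))
   = (fun h : R => h^-1 *: ((f \o shift (x + t *: v)) (h *: v) - f (x + t *: v))).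
  apply/funext => h /=; congr (_ *: (f _ - _)).
  by rewrite [h%:A]mulr1 scalerDl addrCA.
apply: DeriveDef; last by rewrite /derive E.
by rewrite /derivable E; exact: diff_derivable.
Qed.

Lemma derive_gradient f x v : differentiable f x -> 'D_v f x = dotv v (gradient f x).
Proof.
move=> df; rewrite deriveE // dotvE.
rewrite -(linear_sum_delta (F := fun u => 'd f x u)) => [|c s t]; last first.
  by rewrite linearD linearZ.
by apply: eq_bigr => i _; rewrite mxE /partial deriveE.
Qed.

Lemma C2_line f x v : C2_near x f ->
  (\forall t \near (0 : R), is_derive t (1 : R) (fun s => f (x + s *: v))
     (dotv v (gradient f (x + t *: v))))
  /\ is_derive (0 : R) (1 : R) (fun t => dotv v (gradient f (x + t *: v)))
     (bil (hessian f x) v v).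
Proof.
move=> [U [oU Ux] [C1 C2]]; split.
  have /(near_line v) : \forall y \near x, U y by exact: open_nbhs_nbhs.
  apply: filterS => t Ut; rewrite -derive_gradient; last by have [] := C1 _ Ut.
  by apply: is_derive_line; have [] := C1 _ Ut.
have -> : (fun t => dotv v (gradient f (x + t *: v)))
    = \sum_i (v 0 i *: (fun t : R => partial i f (x + t *: v))).
  by apply/funext => t; rewrite fct_sumE dotvE; apply: eq_bigr => i _; rewrite mxE.
have -> : bil (hessian f x) v v = \sum_i v 0 i *: 'D_v (partial i f) (x + 0 *: v).
  rewrite scale0r addr0 /bil mxE.
  transitivity (\sum_i \sum_j v 0 i * (v 0 j * partial j (partial i f) x)).
    rewrite exchange_big /=; apply: eq_bigr => j _; rewrite !mxE mulr_suml.
    by apply: eq_bigr => i _; rewrite !mxE; ring.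
  apply: eq_bigr => i _; rewrite -mulr_sumr derive_gradient; last by have [] := C2 i _ Ux.
  by rewrite dotvE; congr (_ * _); apply: eq_bigr => j _; rewrite mxE.
apply: is_derive_sum => i; apply: is_deriveZ; apply: is_derive_line.
by rewrite scale0r addr0; have [] := C2 i _ Ux.
Qed.
End Lines.

Section Contact1.
Context {R : realType}.
Implicit Types (f g : R -> R).

(** The factor [s] covers contact from above and from below at once. *)
Lemma contact_derive2 (s : R) f f1 (f2 : R) g g1 (g2 : R) :
  (\forall t \near (0 : R), is_derive t (1 : R) f (f1 t)) -> is_derive (0 : R) (1 : R) f1 f2 ->
  (\forall t \near (0 : R), is_derive t (1 : R) g (g1 t)) -> is_derive (0 : R) (1 : R) g1 g2 ->
  f 0 = g 0 -> (\forall t \near (0 : R), 0 <= s * (f t - g t)) ->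
  0 <= s * (f2 - g2).
Proof.
move=> df df1 dg dg1 fg0 fg.
pose k : R -> R := s *: (f - g).
pose k1 : R -> R := s *: (f1 - g1).
have kE t : k t = s * (f t - g t) by [].
have k0 : k 0 = 0 by rewrite kE fg0 subrr mulr0.
have dk : \forall t \near (0 : R), is_derive t (1 : R) k (k1 t).
  by apply: filterS2 df dg => t dft dgt; apply: is_deriveZ.
have dk1 : is_derive (0 : R) (1 : R) k1 (s * (f2 - g2)) by apply: is_deriveZ.
have k1z : k1 0 = 0.
  have : \forall t \near (0 : R), is_derive t (1 : R) k (k1 t) /\ 0 <= s * (f t - g t).
    exact: filterI dk fg.
  move=> /nbhs_ballP[e /= e0 he].
  have B t : t \in `]- e, e[%R -> ball (0 : R) e t.
    by rewrite in_itv /= /ball /= sub0r normrN ltr_norml.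
  have /(@derive_val _ _ _ _ _ _ _) H : is_derive (0 : R) (1 : R) k 0.
    apply: (@derive1_at_min _ k (- e) e 0).
    - by rewrite ge0_cp // ltW.
    - by move=> t /B/he[[? _]].
    - by rewrite in_itv /= oppr_lt0 e0.
    - by move=> t /B/he[_]; rewrite k0.
  have /(@derive_val _ _ _ _ _ _ _) := nbhs_singleton dk.
  by rewrite H.
apply: (right_derive2_ge0 dk dk1 k0 k1z).
by apply: cvg_within; apply: filterS fg.
Qed.

Lemma is_derive_quadratic (a b c t : R) :
  is_derive t (1 : R) (fun s => a + b * s + c * s ^+ 2) (b + 2 * c * t).
Proof.
have -> : (fun s => a + b * s + c * s ^+ 2) = cst a + b *: id + c *: (id ^+ 2 : R -> R).
  by apply/funext => s; rewrite /= exprfctE.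
have did := @is_derive_id R R t 1.
have d1 := is_deriveD (is_deriveD (@is_derive_cst R R R a t 1) (is_deriveZ b did))
  (is_deriveZ c (is_deriveX 2 did)).
by apply: (is_derive_eq d1); rewrite /GRing.scale /=; ring.
Qed.
End Contact1.

Section Contact.
Context {R : realType} {n : nat}.
Implicit Types (x y v : 'rV[R]_n) (u phi : 'rV[R]_n -> R).

Lemma contact_hessian u phi x : C2_near x u -> C2_near x phi -> phi x = u x ->
  (\forall y \near x, u y <= phi y) ->
  forall v, bil (hessian u x) v v <= bil (hessian phi x) v v.
Proof.
move=> Cu Cphi eqx le v.
have [du du1] := C2_line v Cu; have [dp dp1] := C2_line v Cphi.
rewrite -subr_ge0 -[_ - _]mul1r.
apply: (contact_derive2 dp dp1 du du1); first by rewrite scale0r addr0.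
by apply: filterS (near_line v le) => t; rewrite mul1r subr_ge0.
Qed.

Lemma contact_quadratic (s : R) u (M : 'M[R]_n) b : C2_near b u ->
  u b = 1 / 2 * bil M b b -> (forall y, 0 <= s * (1 / 2 * bil M y y - u y)) ->
  forall v, 0 <= s * (bil M v v - bil (hessian u b) v v).
Proof.
move=> Cu ub le v; have [du du1] := C2_line v Cu.
pose q (t : R) := 1 / 2 * bil M (b + t *: v) (b + t *: v).
pose B := bil M b v + bil M v b.
have qE t : q t = 1 / 2 * bil M b b + (1 / 2 * B) * t + (1 / 2 * bil M v v) * t ^+ 2.
  by rewrite /q -[t *: v]opprK -scaleNr bil_subZ /B; ring.
have dq t : is_derive t (1 : R) q (1 / 2 * B + bil M v v * t).
  rewrite (funext qE); apply: (is_derive_eq (is_derive_quadratic _ _ _ _)).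
  by field.
have dq1 : is_derive (0 : R) (1 : R) (fun t => 1 / 2 * B + bil M v v * t) (bil M v v).
  have -> : (fun t => 1 / 2 * B + bil M v v * t)
      = (fun t => 1 / 2 * B + bil M v v * t + 0 * t ^+ 2).
    by apply/funext => t; rewrite mul0r addr0.
  by apply: (is_derive_eq (is_derive_quadratic _ _ _ _)); ring.
apply: (contact_derive2 _ dq1 du du1).
- by near=> t; exact: dq.
- by rewrite /q scale0r addr0 ub.
- by near=> t; exact: le.
Unshelve. all: by end_near. Qed.

(** On the ray of [v], [u] is [t^2 u(v)] for [t > 0]. Comparison to first order,
    along [v] and [- v], shows that the gradient of [phi] vanishes; the
    second-order terms can then be compared. *)
Lemma contact_origin (s : R) u phi : positively_homogeneous 2 u -> C2_near 0 phi ->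
  phi 0 = 0 -> (\forall y \near (0 : 'rV[R]_n), 0 <= s * (phi y - u y)) ->
  forall v, 0 <= s * (bil (hessian phi 0) v v - 2 * u v).
Proof.
move=> hu Cphi phi0 le.
have right v : \forall t \near (0 : R)^'+, 0 <= s * (phi (0 + t *: v) - t ^+ 2 * u v).
  near=> t; have t0 : 0 < t by near: t; exact: nbhs_right_gt.
  rewrite -hu // -[X in u X]add0r; near: t.
  by apply: cvg_within; exact: near_line le.
have dk v : \forall t \near (0 : R), is_derive t (1 : R)
    (fun t => s * (phi (0 + t *: v) - t ^+ 2 * u v))
    (s * (dotv v (gradient phi (0 + t *: v)) - 2 * u v * t)).
  have [dp _] := C2_line v Cphi; apply: filterS dp => t dp.
  have dq := is_derive_quadratic 0 0 (u v) t.
  have -> : (fun t => s * (phi (0 + t *: v) - t ^+ 2 * u v))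
      = s *: ((fun t : R => phi (0 + t *: v)) - (fun t => 0 + 0 * t + u v * t ^+ 2)).
    by apply/funext => r; rewrite !fctE /GRing.scale /=; ring.
  by apply: is_derive_eq; rewrite /GRing.scale /=; ring.
have dk1 v : is_derive (0 : R) (1 : R)
    (fun t => s * (dotv v (gradient phi (0 + t *: v)) - 2 * u v * t))
    (s * (bil (hessian phi 0) v v - 2 * u v)).
  have [_ dp] := C2_line v Cphi.
  have dq := is_derive_quadratic 0 (2 * u v) 0 0.
  have -> : (fun t => s * (dotv v (gradient phi (0 + t *: v)) - 2 * u v * t))
      = s *: ((fun t : R => dotv v (gradient phi (0 + t *: v)))
               - (fun t => 0 + 2 * u v * t + 0 * t ^+ 2)).
    by apply/funext => r; rewrite !fctE /GRing.scale /=; ring.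
  by apply: is_derive_eq; rewrite /GRing.scale /=; ring.
have g0 v : 0 <= s * dotv v (gradient phi 0).
  have := nbhs_singleton (dk v); rewrite scale0r addr0 mulr0 subr0 => /right_derive_ge0; apply => //.
  by rewrite scale0r addr0 phi0 expr0n mul0r subrr mulr0.
move=> v; apply: (right_derive2_ge0 (dk v) (dk1 v) _ _ (right v)).
  by rewrite scale0r addr0 phi0 expr0n mul0r subrr mulr0.
rewrite scale0r addr0 mulr0 subr0; apply/eqP; rewrite eq_le g0 andbT.
by have := g0 (- v); rewrite dotvNl mulrN oppr_ge0.
Unshelve. all: by end_near. Qed.
End Contact.

(** * The elliptic operator as a lower envelope *)

Section Operator.
Context {R : realType} {n : nat}.
Implicit Types (M N : 'M[R]_n) (v : 'rV[R]_n).

Lemma psd_bil_ge0 N v : psd N -> 0 <= bil N v v.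
Proof. by move=> pN; exact: (pN v). Qed.

Lemma psd_tr_ge0 N : psd N -> 0 <= \tr N.
Proof.
move=> pN; have := @mxtrace_congr_ge0 _ _ N 1%:M (fun i => pN _).
by rewrite trmx1 mulmx1 mul1mx.
Qed.

(** From the compression of [N] by [1 - v^T v], whose trace is nonnegative. *)
Lemma psd_bil_le_tr N v : psd N -> dotv v v <= 1 -> bil N v v <= \tr N.
Proof.
move=> pN v1.
have := @mxtrace_congr_ge0 _ _ N (1%:M - v^T *m v) (fun i => pN _).
have -> : (1%:M - v^T *m v)^T = 1%:M - v^T *m v.
  by rewrite linearB /= trmx1 trmx_mul trmxK.
set P := v^T *m v => H.
have tP : \tr (N *m P) = bil N v v by rewrite mxtrace_outer.
have {}H : 0 <= \tr N - \tr (N *m P) - (\tr (N *m P) - \tr (P *m N *m P)).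
  move: H; rewrite mulmxBr !mulmxBl !mulmx1 !mul1mx !mxtraceB.
  by rewrite [\tr (P *m N)]mxtrace_mulC => H; lra.
have tPP : \tr (P *m N *m P) = dotv v v * bil N v v.
  rewrite mxtrace_outer bil_dotv !mulmxA (mx11_scalar (v *m v^T)) -/(dotv v v).
  by rewrite mul_scalar_mx -scalemxAl dotvZl.
have b0 : 0 <= (1 - dotv v v) * bil N v v.
  by apply: mulr_ge0; [rewrite subr_ge0|exact: psd_bil_ge0].
move: H; rewrite tPP tP; lra.
Qed.

Definition rayleigh_set M : set R := [set bil M v v | v in [set v | dotv v v <= 1]].

(** Taken over the ball and not over the sphere, this is the positive part of
    the largest eigenvalue of the symmetric part of [M]. *)
Definition rayleigh_sup M : R := sup (rayleigh_set M).

Lemma has_sup_rayleigh_set M : has_sup (rayleigh_set M).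
Proof.
split; first by exists (bil M 0 0), 0 => //=; rewrite /dotv mul0mx mxE.
exists (\sum_i \sum_j `|M i j|) => _ [v /= v1 <-].
have vi i : `|v 0 i| <= 1.
  rewrite -(@ler_pXn2r _ 2) ?nnegrE // expr1n real_normK ?num_real //.
  apply: le_trans v1; rewrite dotvE (bigD1 i) //= expr2 lerDl.
  by rewrite sumr_ge0 // => k _; rewrite -expr2 sqr_ge0.
rewrite /bil mxE exchange_big /=; apply: ler_sum => j _.
rewrite !mxE mulr_suml; apply: ler_sum => i _.
rewrite (le_trans (ler_norm _)) // !normrM mulrAC.
by rewrite ler_piMl // mulr_ile1.
Qed.

Lemma rayleigh_sup_ge M v : dotv v v <= 1 -> bil M v v <= rayleigh_sup M.
Proof. by move=> v1; apply: sup_upper_bound (has_sup_rayleigh_set M) _ _; exists v. Qed.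

Lemma rayleigh_sup_le M (b : R) : (forall v, dotv v v <= 1 -> bil M v v <= b) -> rayleigh_sup M <= b.
Proof.
move=> H; apply: ge_sup; first by have [] := has_sup_rayleigh_set M.
by move=> _ [v /= v1 <-]; exact: H.
Qed.

Lemma rayleigh_supD M N : rayleigh_sup (M + N) <= rayleigh_sup M + rayleigh_sup N.
Proof. by apply: rayleigh_sup_le => v v1; rewrite bilDM lerD ?rayleigh_sup_ge. Qed.

Lemma rayleigh_sup0 : rayleigh_sup 0 = 0.
Proof.
apply/eqP; rewrite eq_le; apply/andP; split.
  by apply: rayleigh_sup_le => v _; rewrite /bil mulmx0 mul0mx mxE.
rewrite -[leLHS](_ : bil (0 : 'M[R]_n) 0 0 = 0); last by rewrite /bil !mul0mx mxE.
by apply: rayleigh_sup_ge; rewrite /dotv mul0mx mxE.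
Qed.

Variables (K : R) (T : Type) (A : T -> 'M[R]_n) (D : set T) (b : T).
Hypothesis K_ge0 : 0 <= K.
Hypothesis Db : D b.

Definition extremal M : R := \tr M + K * rayleigh_sup M.

Hypothesis extremal_ge0 : forall x y, D x -> D y -> 0 <= extremal (A y - A x).

(** The lower envelope of the translates of [extremal] that vanish at one of
    the matrices [A x]. *)
Definition envelope M : R := inf [set extremal (M - A x) | x in D].

Lemma extremalD M N : extremal (M + N) <= extremal M + extremal N.
Proof.
by rewrite /extremal mxtraceD addrACA lerD2l -mulrDr ler_wpM2l ?rayleigh_supD.
Qed.

Lemma extremal_psd M N : psd N ->
  extremal M + \tr N <= extremal (M + N) <= extremal M + (1 + K) * \tr N.
Proof.
move=> pN; apply/andP; split.
  rewrite /extremal mxtraceD addrAC lerD2l ler_wpM2l //.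
  apply: rayleigh_sup_le => v v1; apply: le_trans (rayleigh_sup_ge _ v1).
  by rewrite bilDM lerDl psd_bil_ge0.
apply: le_trans (extremalD _ _) _; rewrite lerD2l mulrDl mul1r lerD2l ler_wpM2l //.
by apply: rayleigh_sup_le => v v1; exact: psd_bil_le_tr.
Qed.

Lemma has_inf_extremal M : has_inf [set extremal (M - A x) | x in D].
Proof.
split; first by exists (extremal (M - A b)), b.
exists (- extremal (A b - M)) => _ [x Dx <-].
rewrite lerNl -subr_ge0 opprK; apply: le_trans (extremal_ge0 Dx Db) _.
by have := extremalD (A b - M) (M - A x); rewrite addrA subrK.
Qed.

Lemma envelope_le M x : D x -> envelope M <= extremal (M - A x).
Proof. by move=> Dx; apply: (inf_lbound (has_inf_extremal M).2); exists x. Qed.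

Lemma envelope_ge M (c : R) : (forall x, D x -> c <= extremal (M - A x)) -> c <= envelope M.
Proof.
move=> H; apply: lb_le_inf; first by have [] := has_inf_extremal M.
by move=> _ [x Dx <-]; exact: H.
Qed.

Lemma envelope_psd M N : psd N ->
  \tr N <= envelope (M + N) - envelope M <= (1 + K) * \tr N.
Proof.
move=> pN; apply/andP; split.
  rewrite lerBrDl; apply: envelope_ge => x Dx; rewrite addrAC.
  have /andP[H _] := extremal_psd (M - A x) pN.
  by apply: le_trans H; rewrite lerD2r envelope_le.
rewrite lerBlDl -lerBlDr; apply: envelope_ge => x Dx; rewrite lerBlDr.
have /andP[_ H] := extremal_psd (M - A x) pN.
by apply: le_trans H; rewrite addrAC; exact: envelope_le.
Qed.

Lemma envelope0 x : D x -> envelope (A x) = 0.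
Proof.
move=> Dx; apply/eqP; rewrite eq_le; apply/andP; split; last first.
  by apply: envelope_ge => y Dy; exact: extremal_ge0.
have := envelope_le (A x) Dx; rewrite subrr /extremal mxtrace0 rayleigh_sup0 mulr0 addr0.
by [].
Qed.

Lemma envelope_mono M N : (forall v, bil M v v <= bil N v v) -> envelope M <= envelope N.
Proof.
move=> MN; have pN : psd (N - M).
  by move=> v; rewrite -/(bil _ v v) bilDM bilNM subr_ge0.
have /andP[H _] := envelope_psd M pN.
move: H; rewrite [M + _]addrC subrK => H; rewrite -subr_ge0.
exact: le_trans (psd_tr_ge0 pN) H.
Qed.
End Operator.

(** * Regularity of functions homogeneous of degree two *)

Section Regularity.
Context {R : realType} {n : nat}.
Implicit Types (x y v : 'rV[R]_n) (a : @rexpr R n).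

Lemma continuous_rowP (g : 'rV[R]_n -> 'rV[R]_n) x :
  (forall i, {for x, continuous (fun y => g y 0 i)}) -> {for x, continuous g}.
Proof.
move=> gi; have -> : g = fun y => \sum_i g y 0 i *: delta_mx 0 i.
  by apply/funext => y; rewrite -row_sum_delta.
have FF : Filter (nbhs x) by exact: nbhs_filter.
apply: (cvg_big (@add_continuous _) FF) => i _.
by apply: cvgZr_tmp; exact: gi.
Qed.

Lemma rho_le_normr x : rho x ^+ 2 <= n%:R * `|x| ^+ 2.
Proof.
rewrite sqr_rho dotvE -[n in n%:R]card_ord mulr_natl -sumr_const.
apply: ler_sum => i _; rewrite -expr2 -real_normK ?num_real // lerXn2r ?nnegrE //.
exact: coord_le_normr.
Qed.

Lemma differentiable_small (f : 'rV[R]_n -> R) (K : R) : 0 <= K ->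
  (forall h, `|f h| <= K * `|h| ^+ 2) ->
  differentiable f 0 /\ forall v, 'D_v f 0 = 0.
Proof.
move=> K0 fK.
have f0 : f 0 = 0.
  by apply/eqP; rewrite -normr_le0 (le_trans (fK 0)) // normr0 expr0n mulr0.
pose Z : {linear 'rV[R]_n -> R} := \0.
have Zc : continuous (Z : 'rV[R]_n -> R) by exact: cst_continuous.
have ex : f \o shift 0 = cst (f 0) + (Z : 'rV[R]_n -> R) +o_ (0 : 'rV[R]_n) id.
  apply/eqaddoP => _ /posnumP[e].
  have K1 : 0 < K + 1 by rewrite ltr_wpDl.
  have nh : \forall h \near (0 : 'rV[R]_n), `|h| < e%:num / (K + 1).
    apply/nbhs_ballP; exists (e%:num / (K + 1)); first by rewrite /= divr_gt0.
    by move=> h; rewrite -ball_normE /= sub0r normrN.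
  near=> h.
  have -> : (f \o shift 0 - (cst (f 0) + (Z : 'rV[R]_n -> R))) h = f h.
    by rewrite !fctE /= f0 !addr0 subr0.
  rewrite (le_trans (fK h)) // expr2 mulrA ler_wpM2r //.
  have hs : `|h| < e%:num / (K + 1) by near: h; exact: nh.
  apply: le_trans (_ : (K + 1) * `|h| <= _); first by rewrite ler_wpM2r // lerDl.
  by rewrite mulrC -ler_pdivlMr // ltW.
have d0 : 'd f 0 = (Z : 'rV[R]_n -> R) :> ('rV[R]_n -> R).
  by apply: diff_unique.
have df : differentiable f 0.
  by apply/diff_locallyP; rewrite d0; split.
by split => // v; rewrite deriveE // d0.
Unshelve. all: by end_near. Qed.

Lemma rho_le_norm x : rho x <= n%:R * `|x|.
Proof.
rewrite -(@ler_pXn2r _ 2) ?nnegrE ?sqrtr_ge0 ?mulr_ge0 // (le_trans (rho_le_normr x)) //.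
by rewrite exprMn ler_wpM2r ?sqr_ge0 // -natrX ler_nat -mulnn; case: (n) => // k; rewrite leq_pmulr.
Qed.

Lemma rhom2_small a : rhom a 2 ->
  exists2 K : R, 0 <= K & forall h, `|reval a h| <= K * `|h| ^+ 2.
Proof.
move=> a2; have [K K0 aK] := rhom_bound a2.
exists (K * n%:R) => [|h]; first exact: mulr_ge0.
have [->|h0] := eqVneq h 0; first by rewrite (rhom_reval0 a2) // !normr0 expr0n mulr0.
by rewrite (le_trans (aK h h0)) // -mulrA ler_wpM2l // -exprnP rho_le_normr.
Qed.

Lemma rhom1_small a : rhom a 1 ->
  exists2 K : R, 0 <= K & forall h, `|reval a h| <= K * `|h|.
Proof.
move=> a1; have [K K0 aK] := rhom_bound a1.
exists (K * n%:R) => [|h]; first exact: mulr_ge0.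
have [->|h0] := eqVneq h 0; first by rewrite (rhom_reval0 a1) // !normr0 mulr0.
by rewrite (le_trans (aK h h0)) // -mulrA ler_wpM2l // expr1z rho_le_norm.
Qed.

Lemma differentiable_rhom2 a x : rhom a 2 -> differentiable (reval a) x.
Proof.
move=> a2; have [->|x0] := eqVneq x 0; last exact: differentiable_reval.
by have [K K0 aK] := rhom2_small a2; have [] := differentiable_small K0 aK.
Qed.

Lemma derive_rhom2 a v x : rhom a 2 -> 'D_v (reval a) x = reval (rder v a) x.
Proof.
move=> a2; have [->|x0] := eqVneq x 0; last exact: derive_reval.
have [K K0 aK] := rhom2_small a2; have [_ ->] := differentiable_small K0 aK.
by rewrite (rhom_reval0 (rhom_der v a2)).
Qed.

Lemma gradient_rhom2 a : rhom a 2 ->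
  gradient (reval a) = fun x => \row_i reval (rder (delta_mx 0 i) a) x.
Proof.
by move=> a2; apply/funext => x; apply/rowP => i; rewrite !mxE /partial derive_rhom2.
Qed.

Lemma continuous_rhom1 a : rhom a 1 -> continuous (reval a).
Proof.
move=> a1 x; have [->|x0] := eqVneq x 0; last first.
  exact/differentiable_continuous/differentiable_reval.
have [K K0 aK] := rhom1_small a1.
have FF : Filter (nbhs (0 : 'rV[R]_n)) by exact: nbhs_filter.
apply/(@cvgrPdist_lt _ _ _ (nbhs (0 : 'rV[R]_n)) FF) => e e0; rewrite (rhom_reval0 a1) //.
have K1 : 0 < K + 1 by rewrite ltr_wpDl.
apply/nbhs_ballP; exists (e / (K + 1)); first by rewrite /= divr_gt0.
move=> h; rewrite -ball_normE /= !sub0r !normrN => he.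
apply: le_lt_trans (aK h) _; apply: le_lt_trans (_ : (K + 1) * `|h| < _).
  by rewrite ler_wpM2r // lerDl.
by rewrite mulrC -ltr_pdivlMr.
Qed.

Lemma C1_rhom2 a : rhom a 2 -> C1_on setT (reval a).
Proof.
move=> a2 x _; split; first exact: differentiable_rhom2.
rewrite gradient_rhom2 //; apply: continuous_rowP => i.
under [X in {for _, continuous X}]eq_fun do rewrite mxE.
exact: continuous_rhom1 (rhom_der _ a2) x.
Qed.

Lemma C1_reval a : C1_on (~` [set 0]) (reval a).
Proof.
move=> x /eqP x0; split; first exact: differentiable_reval.
apply: continuous_rowP => i.
have E : \forall y \near x, reval (rder (delta_mx 0 i) a) y = gradient (reval a) y 0 i.
  near=> y; have y0 : y != 0 by near: y; exact: near_neq0.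
  by rewrite mxE /partial derive_reval.
have gx : gradient (reval a) x 0 i = reval (rder (delta_mx 0 i) a) x.
  by rewrite mxE /partial derive_reval.
have H : reval (rder (delta_mx 0 i) a) y @[y --> x] --> gradient (reval a) x 0 i.
  by rewrite gx; exact/differentiable_continuous/differentiable_reval.
exact: cvg_trans (near_eq_cvg E) H.
Unshelve. all: by end_near. Qed.

Lemma C2_near_rhom2 a x : rhom a 2 -> x != 0 -> C2_near x (reval a).
Proof.
move=> a2 x0; exists (~` [set 0]); last split; last 1 first.
- move=> i; rewrite (_ : partial i (reval a) = reval (rder (delta_mx 0 i) a)).
    exact: C1_reval.
  by apply/funext => y; rewrite /partial derive_rhom2.
- split; last exact/eqP.
  rewrite openE => y /eqP/near_neq0 H; rewrite /interior.
  by apply: filterS H => z /eqP.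
- exact: C1_reval.
Qed.

Lemma euler_rhom a k x : x != 0 -> rhom a k -> reval (rder x a) x = k%:~R * reval a x.
Proof.
move=> x0; elim => {a k} [k|c|u||a b k _ IHa _ IHb|a b k l p _ IHa _ IHb <-] /=.
- by rewrite mulr0.
- by rewrite mul0r.
- by rewrite mul1r.
- by rewrite -sqr_rho; field; exact: rho_neq0.
- by rewrite IHa IHb mulrDr.
- by rewrite IHa IHb rmorphD /=; ring.
Qed.

End Regularity.

Section LipschitzGradient.
Context {R : realType} {n : nat}.
Implicit Types (x y v : 'rV[R]_n) (a : @rexpr R n).

Lemma derive_rhom1_bound a : rhom a 1 ->
  exists2 K : R, 0 <= K & forall x v, x != 0 -> `|'D_v (reval a) x| <= K * `|v|.
Proof.
move=> a1.
have /choice[K HK] : forall i : 'I_n, exists K : R, 0 <= K /\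
    forall x, x != 0 -> `|reval (rder (delta_mx 0 i) a) x| <= K.
  move=> i; have [K K0 HK] := rhom_bound (rhom_der (delta_mx 0 i) a1).
  exists K; split => // x x0.
  by have := HK x x0; rewrite subrr expr0z mulr1.
exists (\sum_i K i) => [|x v x0]; first by apply: sumr_ge0 => i _; have [] := HK i.
rewrite derive_gradient; last exact: differentiable_reval.
rewrite dotvE mulr_suml (le_trans (ler_norm_sum _ _ _)) //; apply: ler_sum => i _.
rewrite normrM mulrC ler_pM // ?coord_le_normr // mxE /partial derive_reval //.
by have [_] := HK i; apply.
Qed.

(** Derivatives have degree zero, hence are bounded, and the mean value theorem
    applies on segments that avoid the origin. If the segment from [x] to [y]
    meets the origin, its length is [|x| + |y|], which bounds the two values
    separately. *)
Lemma lipschitz_rhom1 a : rhom a 1 ->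
  exists2 K : R, 0 <= K & forall x y, `|reval a x - reval a y| <= K * `|x - y|.
Proof.
move=> a1; have [K1 K10 aK1] := derive_rhom1_bound a1.
have [K2 K20 aK2] := rhom1_small a1.
exists (K1 + K2) => [|x y]; first exact: addr_ge0.
have [[t [t01 t0]]|no0] := pselect (exists t : R, 0 <= t <= 1 /\ x + t *: (y - x) = 0).
  (* the segment meets the origin: use the bound by the norms of the endpoints *)
  have xE : x = - (t *: (y - x)) by apply/eqP; rewrite -addr_eq0 t0.
  have yE : y = (1 - t) *: (y - x) by rewrite scalerBl scale1r -xE subrK.
  rewrite distrC [X in _ <= _ * X]distrC (le_trans (ler_normB _ _)) //.
  have /andP[t0' t1] := t01.
  have nx : `|x| = t * `|y - x| by rewrite {1}xE normrN normrZ ger0_norm.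
  have ny : `|y| = (1 - t) * `|y - x| by rewrite {1}yE normrZ ger0_norm // subr_ge0.
  have hx := aK2 x; have hy := aK2 y; rewrite nx in hx; rewrite ny in hy.
  have : 0 <= K1 * `|y - x| by rewrite mulr_ge0.
  lra.
have n0 t : 0 <= t <= 1 -> x + t *: (y - x) != 0.
  by move=> t01; apply/eqP => H; apply: no0; exists t.
pose g t := reval a (x + t *: (y - x)).
have dg (t : R) : 0 <= t <= 1 ->
    is_derive t (1 : R) g ('D_(y - x) (reval a) (x + t *: (y - x))).
  by move=> t01; apply: is_derive_line; exact/differentiable_reval/n0.
have [t|t|c] := @MVT R g (fun t => 'D_(y - x) (reval a) (x + t *: (y - x))) 0 1 ltr01.
- by rewrite in_itv /= => /andP[t0 t1]; apply: dg; rewrite !ltW.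
- apply: continuous_in_subspaceT => {}t; rewrite inE /= in_itv /= => t01.
  by have [dgt _] := dg t t01; apply/differentiable_continuous/derivable1_diffP.
rewrite in_itv /= => /andP[c0 c1]; rewrite /g scale1r scale0r addr0 subr0 mulr1.
rewrite [x + (y - x)]addrC subrK => E; rewrite distrC E [X in _ <= _ * X]distrC.
have c01 : 0 <= c <= 1 by rewrite !ltW.
apply: (le_trans (aK1 _ _ (n0 c c01))).
by rewrite ler_wpM2r // lerDl.
Qed.

Lemma C11_rhom2 a : rhom a 2 -> C11 (reval a).
Proof.
move=> a2; split; first exact: C1_rhom2.
have /choice[K HK] : forall i : 'I_n, exists K : R, 0 <= K /\ forall x y,
    `|reval (rder (delta_mx 0 i) a) x - reval (rder (delta_mx 0 i) a) y| <= K * `|x - y|.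
  by move=> i; have [K K0 HK] := lipschitz_rhom1 (rhom_der (delta_mx 0 i) a2); exists K.
have PF : ProperFilter (globally ([set: 'rV[R]_n] `*` [set: 'rV[R]_n])).
  exact: (@globally_properfilter _ _ (0, 0)).
apply: (@klipschitzW _ _ _ (\sum_i K i)) => -[x y] _ /=.
have S0 : 0 <= \sum_i K i by apply: sumr_ge0 => i _; have [] := HK i.
rewrite gradient_rhom2 // [leLHS]/Num.norm /= mx_normrE; apply/bigmax_leP.
split=> [|[i j] _ /=]; first exact: mulr_ge0.
rewrite ord1 !mxE; have [_ /(_ x y) H] := HK j; apply: le_trans H _.
rewrite ler_wpM2r // (bigD1 j) //= lerDl; apply: sumr_ge0 => k _.
by have [] := HK k.
Qed.

Lemma derive0_rhom1 a v : rhom a 1 -> differentiable (reval a) 0 ->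
  'D_v (reval a) 0 = reval a v.
Proof.
move=> a1 da; have /(cvg_at_rightE _) : derivable (reval a) 0 v by exact: diff_derivable.
rewrite /derive => ->.
apply: cvg_lim => //; apply: (@cvg_trans _ (cst (reval a v) @ (0 : R)^'+)); last exact: cvg_cst.
apply: near_eq_cvg; near=> h; have h0 : 0 < h by near: h; exact: nbhs_right_gt.
rewrite /= addr0 (rhom_reval0 a1) // subr0 (rhom_scale _ a1 h0) expr1z /GRing.scale /=.
by rewrite mulKf // gt_eqF.
Unshelve. all: by end_near. Qed.

(** A partial derivative has degree one, so if it is differentiable at the
    origin it equals its differential there and is odd. By Euler's identity
    [2 a(v) = v . grad a(v)], so [a] is even; being odd, it vanishes. *)
Lemma not_twice_differentiable_rhom2 a : rhom a 2 ->
  (forall x, reval a (- x) = - reval a x) -> (exists x, reval a x != 0) ->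
  ~ twice_differentiable_at 0 (reval a).
Proof.
move=> a2 oda [x ax] [_ dg].
have x0 : x != 0 by apply: contraNneq ax => ->; rewrite (rhom_reval0 a2).
pose g i := reval (rder (delta_mx 0 i) a).
have dgi i : differentiable (g i) 0.
  have -> : g i = (fun M : 'rV[R]_n => M 0 i : R) \o gradient (reval a).
    by apply/funext => y; rewrite gradient_rhom2 //= mxE.
  by apply: differentiable_comp => //; exact: differentiable_coord.
have oddg i v : g i (- v) = - g i v.
  have gE u : g i u = 'd (g i) 0 u.
    rewrite -deriveE; last exact: dgi.
    by rewrite (derive0_rhom1 _ (rhom_der _ a2) (dgi i)).
  by rewrite !gE linearN.
have euler v : v != 0 -> dotv v (\row_i g i v) = 2 * reval a v.
  move=> v0; rewrite -(euler_rhom v0 a2) -derive_rhom2 // derive_gradient.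
    by rewrite gradient_rhom2.
  exact: differentiable_rhom2.
have e1 := euler x x0; have e2 := euler (- x); rewrite oppr_eq0 in e2.
have {e2} := e2 x0; rewrite oda.
have -> : (\row_i g i (- x)) = - (\row_i g i x) by apply/rowP => i; rewrite !mxE oddg.
rewrite dotvNl dotvNr opprK e1 => H; move/eqP: ax; apply.
by move: H; lra.
Qed.
End LipschitzGradient.

(** * The equation *)

Section Origin.
Context {R : realType} {n : nat}.
Implicit Types (x y v b : 'rV[R]_n) (M : 'M[R]_n) (u : 'rV[R]_n -> R).

(** The form [M] is moved towards [u] by a multiple of the identity, namely the
    minimum over the unit sphere of the gap between them, until it touches [u]
    at a unit vector [b]. Homogeneity keeps it on the same side of [u]
    everywhere, so its Hessian compares with that of [u] at [b], and restoring
    the multiple of the identity only helps. *)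
Lemma quadratic_contact_origin (s : R) u M : s ^+ 2 = 1 -> continuous u ->
  positively_homogeneous 2 u -> u 0 = 0 -> (forall x, x != 0 -> C2_near x u) ->
  (exists x : 'rV[R]_n, x != 0) ->
  (forall v, 0 <= s * (bil M v v - 2 * u v)) ->
  exists2 b, b != 0 & forall v, 0 <= s * (bil M v v - bil (hessian u b) v v).
Proof.
move=> s1 cu hu u0 Cu [x0 x00] le.
pose h v := s * (bil M v v - 2 * u v).
have [|||b bS hb] := @EVT_min_rV R n h [set v | dotv v v = 1 /\ dotv v 0 = 0].
- exists (unitv x0); split; first exact: dotv_unitv.
  by rewrite /dotv trmx0 mulmx0 mxE.
- exact: compact_sphere_perp.
- apply: continuous_subspaceT => x; rewrite /h.
  have FF : Filter (nbhs x) by exact: nbhs_filter.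
  apply: cvgMl_tmp; apply: (@cvgB _ _ _ (nbhs x) FF); first exact: continuous_bil.
  by apply: (@cvgMl_tmp _ _ (nbhs x) FF); exact: cu.
move: bS; rewrite inE => -[bb _].
have b0 : b != 0.
  by apply/eqP => bz; move: bb; rewrite bz /dotv mul0mx mxE => /esym/eqP; rewrite oner_eq0.
have hh v : h b * dotv v v <= h v.
  have [->|v0] := eqVneq v 0; first by rewrite /h u0 /bil /dotv !mul0mx !mxE !mulr0 subr0 mulr0.
  have vE : v = rho v *: unitv v by rewrite scalerA mulfV ?rho_neq0 // scale1r.
  have -> : h v = h (unitv v) * dotv v v.
    have -> : h v = s * (bil M v v - 2 * (rho v ^+ 2 * u (unitv v))).
      by rewrite -hu ?rho_gt0 // -vE.
    by rewrite /h bil_unitv -sqr_rho; field; exact: rho_neq0.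
  rewrite ler_wpM2r ?dotv_ge0 // hb // inE; split; first exact: dotv_unitv.
  by rewrite /dotv trmx0 mulmx0 mxE.
exists b => // v.
pose M' := M - (s * h b)%:M.
have bM' y : bil M' y y = bil M y y - s * h b * dotv y y.
  by rewrite bilDM bilNM -scalemx1 bilZM bil1M.
have := @contact_quadratic _ _ s u M' b (Cu b b0) _ _ v.
rewrite !bM' => H.
have sh (t : R) : s * (s * t) = t by rewrite mulrA -expr2 s1 mul1r.
have {H}: 0 <= s * (bil M v v - s * h b * dotv v v - bil (hessian u b) v v).
  apply: H => [|y]; rewrite ?bM'.
    by rewrite bb mulr1 /h sh; field.
  have -> : s * (1 / 2 * (bil M y y - s * h b * dotv y y) - u y)
     = 1 / 2 * (h y - s * (s * (h b * dotv y y))) by rewrite /h; field.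
  by rewrite sh mulr_ge0 ?subr_ge0 ?hh.
have -> : s * (bil M v v - s * h b * dotv v v - bil (hessian u b) v v)
  = s * (bil M v v - bil (hessian u b) v v) - s * (s * (h b * dotv v v)) by ring.
by rewrite sh subr_ge0; apply: le_trans; rewrite mulr_ge0 ?dotv_ge0 ?le.
Qed.
End Origin.

Section Equation.
Context {R : realType} {m d : nat}.
Variable E : 'I_d -> 'M[R]_m.
Hypothesis m3 : (3 <= m)%N.
Hypothesis onE : orthonormal_basis_Sym0 E.
Implicit Types (x y v b : 'rV[R]_d) (M : 'M[R]_d).
Local Notation X := (from_coords E).

Let K : R := (m%:R + 3) * (d%:R + 3).
Let D : set 'rV[R]_d := [set x | x != 0].

Lemma K_ge0 : 0 <= K.
Proof. by rewrite mulr_ge0 ?addr_ge0. Qed.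

(** The constant [K] is such that [hess_gap] compensates exactly the trace
    [- (d + 3) dl]. *)
Lemma extremal_gap (x y : 'rV[R]_d) (P Q : 'M[R]_d) : x != 0 -> y != 0 ->
  (forall v, bil P v v = hessW (X (unitv x)) (X v)) ->
  (forall v, bil Q v v = hessW (X (unitv y)) (X v)) ->
  \tr P = - (d%:R + 3) * \tr (X (unitv x) *m X (unitv x) *m X (unitv x)) ->
  \tr Q = - (d%:R + 3) * \tr (X (unitv y) *m X (unitv y) *m X (unitv y)) ->
  0 <= extremal K (Q - P).
Proof.
move=> x0 y0 bP bQ tP tQ; move: (dotv_unitv x0) (dotv_unitv y0) bP bQ tP tQ.
move: (unitv x) (unitv y) => a b aa bb bP bQ tP tQ.
rewrite /extremal mxtraceB tP tQ.
pose dl := \tr (X b *m X b *m X b) - \tr (X a *m X a *m X a).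
have -> : - (d%:R + 3) * \tr (X b *m X b *m X b) - - (d%:R + 3) * \tr (X a *m X a *m X a)
    = - (d%:R + 3) * dl by rewrite /dl; ring.
have d3 : 0 < d%:R + 3 :> R by rewrite ltr_wpDl.
have m3' : 0 < m%:R + 3 :> R by rewrite ltr_wpDl.
have [dl0|dl0] := ltP 0 dl; last first.
  rewrite addr_ge0 //; first by rewrite mulNr oppr_ge0 mulr_ge0_le0 // ltW.
  rewrite mulr_ge0 ?K_ge0 // -[leLHS](_ : bil (Q - P) 0 0 = 0); last by rewrite /bil !mul0mx mxE.
  by apply: rayleigh_sup_ge; rewrite /dotv mul0mx mxE.
have [||||V [sV tV]] := hess_gap m3 (trmx_from_coords onE b) (trmx_from_coords onE a)
  _ _ _ _ dl0; rewrite ?(mxtrace_from_coords onE) ?(mxtrace_from_coordsM onE) //.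
have [v ->] := from_coords_onto onE sV tV.
rewrite (mxtrace_from_coordsM onE) -bP -bQ -bilNM -bilDM -/dl => gap.
have v0 : v != 0.
  by apply: contraTneq gap => ->; rewrite /bil /dotv !mul0mx mxE mulr0 ltxx.
have : dl / (m%:R + 3) <= rayleigh_sup (Q - P).
  apply: le_trans (rayleigh_sup_ge _ (_ : dotv (unitv v) (unitv v) <= 1)); last by rewrite dotv_unitv.
  rewrite bil_unitv ler_pdivlMr; first exact: ltW.
  by rewrite -sqr_rho exprn_gt0 // rho_gt0.
rewrite ler_pdivrMr // => H.
have -> : - (d%:R + 3) * dl + K * rayleigh_sup (Q - P)
    = (d%:R + 3) * (rayleigh_sup (Q - P) * (m%:R + 3) - dl) by rewrite /K; ring.
by rewrite mulr_ge0 ?subr_ge0 // ltW.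
Qed.

Lemma extremal_hessian_w_ge0 x y : D x -> D y -> 0 <= extremal K (hessian (w E) y - hessian (w E) x).
Proof.
move=> x0 y0; have m0 : (0 < m)%N by apply: leq_trans m3.
apply: (extremal_gap x0 y0) => [v|v||].
- exact: bil_hessian_w.
- exact: bil_hessian_w.
- exact: mxtrace_hessian_w.
- exact: mxtrace_hessian_w.
Qed.

Lemma continuous_w : continuous (w E).
Proof.
by move=> x; rewrite (w_reval onE); apply/differentiable_continuous/differentiable_rhom2/rhom_wexpr.
Qed.

Lemma w0 : w E 0 = 0.
Proof. by rewrite (w_reval onE) (rhom_reval0 (rhom_wexpr E)). Qed.

Lemma homogeneous_w : positively_homogeneous 2 (w E).
Proof. by move=> t x t0; rewrite (w_reval onE) (rhom_scale x (rhom_wexpr E) t0). Qed.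

Lemma C2_w x : x != 0 -> C2_near x (w E).
Proof. by move=> x0; rewrite (w_reval onE); apply: C2_near_rhom2 => //; exact: rhom_wexpr. Qed.

Lemma w_odd x : w E (- x) = - w E x.
Proof.
rewrite (w_reval onE) /= !reval_cubic -scaleN1r from_coordsZ.
rewrite -!scalemxAl -!scalemxAr -!scalemxAl !mxtraceZ /rho dotvZl dotvZr.
by rewrite !mulN1r !opprK mulNr.
Qed.

(** The witness is the diagonal matrix with diagonal [1, 1, -2, 0, ..., 0],
    whose cube has trace [-6]. *)
Lemma w_neq0 : exists x, w E x != 0.
Proof.
pose i k (hk : (k < 3)%N) : 'I_m := Ordinal (leq_trans hk m3).
pose f (j : 'I_m) : R := if (j < 2)%N then 1 else if j == 2%N :> nat then - 2 else 0.
pose V : 'M[R]_m := diag_mx (\row_j f j).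
have sum3 (g : 'I_m -> R) : (forall j : 'I_m, (3 <= j)%N -> g j = 0) ->
    \sum_j g j = g (i 0%N isT) + g (i 1%N isT) + g (i 2%N isT).
  move=> g0; rewrite (bigD1 (i 0%N isT)) // (bigD1 (i 1%N isT)) // (bigD1 (i 2%N isT)) //=.
  rewrite big1 ?addr0 ?addrA // => j /andP[/andP[j0 j1] j2]; apply: g0.
  by move: j0 j1 j2; rewrite -!val_eqE /=; case: (j : nat) => [|[|[|]]].
have f3 (j : 'I_m) : (3 <= j)%N -> f j = 0.
  by rewrite /f; case: (j : nat) => [|[|[|]]].
have tV : \tr V = 0.
  rewrite mxtrace_diag; under eq_bigr do rewrite mxE.
  by rewrite sum3 // /f /=; ring.
have sV : V^T = V by rewrite tr_diag_mx.
have [x xV] := from_coords_onto onE sV tV.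
have tV3 : \tr (V *m V *m V) = - 6.
  rewrite !mulmx_diag mxtrace_diag; under eq_bigr do rewrite !mxE.
  rewrite sum3 => [|j j3]; last by rewrite f3 // mulr0.
  by rewrite /f /=; ring.
exists x; rewrite (w_reval onE) /= reval_cubic -xV tV3 mulf_neq0 //.
rewrite invr_eq0 rho_neq0 //; apply/eqP => x0; move: tV3.
rewrite xV x0 -(scale0r 0) from_coordsZ scale0r !mul0mx mxtrace0 => /esym/eqP.
by rewrite oppr_eq0 pnatr_eq0.
Qed.

Lemma exists_elliptic_operator : exists F : 'M[R]_d -> R,
  uniformly_elliptic 1 (1 + K) F /\ viscosity_solution F setT (w E).
Proof.
have [b wb] := w_neq0.
have b0 : D b by apply: contraNneq wb => ->; rewrite w0.
have extremal_ge0 := extremal_hessian_w_ge0.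
pose A (x : 'rV[R]_d) := hessian (w E) x.
pose F := envelope K A D.
have F0 x : x != 0 -> F (A x) = 0 by move=> x0; apply: (envelope0 K_ge0 b0 extremal_ge0).
have Fmono M N : (forall v, bil M v v <= bil N v v) -> F M <= F N.
  exact: (envelope_mono K_ge0 b0 extremal_ge0).
exists F; split.
  by move=> M N _ _ pN; rewrite mul1r; exact: (envelope_psd K_ge0 b0 extremal_ge0).
split; first exact/continuous_subspaceT/continuous_w.
have origin (s : R) phi : s ^+ 2 = 1 -> C2_near 0 phi -> phi 0 = 0 ->
    (\forall y \near (0 : 'rV[R]_d), 0 <= s * (phi y - w E y)) ->
    exists2 x, x != 0 & forall v, 0 <= s * (bil (hessian phi 0) v v - bil (A x) v v).
  move=> s1 Cphi phi0 le.
  have le2 := contact_origin homogeneous_w Cphi phi0 le.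
  have [x x0 Hx] := quadratic_contact_origin s1 continuous_w homogeneous_w w0 C2_w
    (ex_intro _ b b0) le2.
  by exists x.
move=> x phi _ Cphi; have [x0|x0] := eqVneq x 0; last first.
  split=> -[phix le]; rewrite -(F0 x x0); apply: Fmono => v.
    exact: contact_hessian (C2_w x0) Cphi phix le v.
  by apply: contact_hessian Cphi (C2_w x0) (esym phix) _ v.
subst x; split=> -[]; rewrite w0 => phi0 le.
- have [||x x0 Hx] := origin 1 phi _ Cphi phi0; first by rewrite expr1n.
    by apply: filterS le => y; rewrite mul1r subr_ge0.
  rewrite -(F0 x x0); apply: Fmono => v.
  by have := Hx v; rewrite mul1r subr_ge0.
- have [||x x0 Hx] := origin (-1) phi _ Cphi phi0; first by rewrite sqrrN expr1n.
    by apply: filterS le => y; rewrite mulN1r opprB subr_ge0.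
  rewrite -(F0 x x0); apply: Fmono => v.
  by have := Hx v; rewrite mulN1r opprB subr_ge0.
Qed.

Lemma C11_w : C11 (w E).
Proof. by rewrite (w_reval onE); apply: C11_rhom2; exact: rhom_wexpr. Qed.

Lemma not_twice_differentiable_w : ~ twice_differentiable_at 0 (w E).
Proof.
have := w_odd; have := w_neq0; rewrite (w_reval onE) => w0 wN.
by apply: not_twice_differentiable_rhom2 => //; exact: rhom_wexpr.
Qed.
End Equation.

(** * Polynomials as lists of terms *)

Section TermLists.
Context {R : realType} {n : nat}.
Implicit Types (h x : 'rV[R]_n) (r : R) (P Q : seq (R * {ffun 'I_n -> nat})).
Local Notation index := {ffun 'I_n -> nat}.
Local Notation terms := (seq (R * index)).

Definition deg (a : index) : nat := (\sum_i a i)%N.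

Definition peval P h : R := \sum_(t <- P) t.1 * monomial t.2 h.

(** Terms of a list may repeat an index. [pnorm] is therefore not a function of
    the polynomial, but it is exactly additive and multiplicative on lists, and
    it dominates the same expression in the coefficients [pcoef]. *)
Definition pnorm r P : R := \sum_(t <- P) `|t.1| * r ^+ deg t.2.

Definition pcoef P (a : index) : R := \sum_(t <- P | t.2 == a) t.1.

Definition index0 : index := [ffun=> 0%N].

Definition index1 (i : 'I_n) : index := [ffun j => (j == i) : nat].

Definition indexD (a b : index) : index := [ffun i => (a i + b i)%N].

Definition pconst (c : R) : terms := [:: (c, index0)].

Definition plin (v : 'rV[R]_n) : terms := [seq (v 0 i, index1 i) | i <- index_enum 'I_n].

Definition pmul P Q : terms := [seq (s.1 * t.1, indexD s.2 t.2) | s <- P, t <- Q].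

Lemma monomial0 h : monomial index0 h = 1.
Proof. by rewrite /monomial big1 // => i _; rewrite ffunE expr0. Qed.

Lemma monomial1 i h : monomial (index1 i) h = h 0 i.
Proof.
rewrite /monomial (bigD1 i) //= big1 ?mulr1 => [|j ji]; rewrite ffunE; first by rewrite eqxx expr1.
by rewrite (negbTE ji) expr0.
Qed.

Lemma monomialD a b h : monomial (indexD a b) h = monomial a h * monomial b h.
Proof. by rewrite /monomial -big_split; apply: eq_bigr => i _; rewrite ffunE exprD. Qed.

Lemma deg0 : deg index0 = 0%N.
Proof. by rewrite /deg big1 // => i _; rewrite ffunE. Qed.

Lemma deg1 i : deg (index1 i) = 1%N.
Proof.
rewrite /deg (bigD1 i) //= big1 => [|j ji]; rewrite ffunE; first by rewrite eqxx.
by rewrite (negbTE ji).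
Qed.

Lemma degD a b : deg (indexD a b) = (deg a + deg b)%N.
Proof. by rewrite /deg -big_split; apply: eq_bigr => i _; rewrite ffunE. Qed.

Lemma norm_monomial a h r : `|h| <= r -> `|monomial a h| <= r ^+ deg a.
Proof.
move=> hr; rewrite /monomial normr_prod /deg expr_sum; apply: ler_prod => i _.
rewrite normr_ge0 normrX /= lerXn2r ?nnegrE //; first exact: le_trans hr.
apply: le_trans hr; exact: coord_le_normr.
Qed.

Lemma peval_cat P Q h : peval (P ++ Q) h = peval P h + peval Q h.
Proof. exact: big_cat. Qed.

Lemma pnorm_cat r P Q : pnorm r (P ++ Q) = pnorm r P + pnorm r Q.
Proof. exact: big_cat. Qed.

Lemma pcoef_cat P Q a : pcoef (P ++ Q) a = pcoef P a + pcoef Q a.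
Proof. exact: big_cat. Qed.

Lemma peval_const c h : peval (pconst c) h = c.
Proof. by rewrite /peval big_seq1 monomial0 mulr1. Qed.

Lemma pnorm_const r c : pnorm r (pconst c) = `|c|.
Proof. by rewrite /pnorm big_seq1 deg0 expr0 mulr1. Qed.

Lemma peval_lin v h : peval (plin v) h = dotv h v.
Proof.
rewrite /peval big_map dotvE; apply: eq_bigr => i _ /=.
by rewrite monomial1 mulrC.
Qed.

Lemma pnorm_lin r v : pnorm r (plin v) = (\sum_i `|v 0 i|) * r.
Proof. by rewrite /pnorm big_map mulr_suml; apply: eq_bigr => i _; rewrite deg1. Qed.

Lemma peval_mul P Q h : peval (pmul P Q) h = peval P h * peval Q h.
Proof.
rewrite /peval /pmul big_allpairs_dep mulr_suml; apply: eq_bigr => s _.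
by rewrite mulr_sumr; apply: eq_bigr => t _ /=; rewrite monomialD; ring.
Qed.

Lemma pnorm_mul r P Q : pnorm r (pmul P Q) = pnorm r P * pnorm r Q.
Proof.
rewrite /pnorm /pmul big_allpairs_dep mulr_suml; apply: eq_bigr => s _.
by rewrite mulr_sumr; apply: eq_bigr => t _ /=; rewrite degD exprD normrM; ring.
Qed.

Lemma pmul_cat P P' Q : pmul (P ++ P') Q = pmul P Q ++ pmul P' Q.
Proof. exact: allpairs_cat. Qed.

Lemma pnorm_ge0 r P : 0 <= r -> 0 <= pnorm r P.
Proof. by move=> r0; apply: sumr_ge0 => t _; rewrite mulr_ge0 // exprn_ge0. Qed.

Lemma norm_peval P h r : `|h| <= r -> `|peval P h| <= pnorm r P.
Proof.
move=> hr; apply: le_trans (ler_norm_sum _ _ _) _; apply: ler_sum => t _.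
by rewrite normrM ler_wpM2l // norm_monomial.
Qed.

Lemma sum_fset_pred (B : {fset index}) (a : index) (y : R) :
  \sum_(b : B | a == val b) y = if a \in B then y else 0.
Proof.
case: ifPn => aB; last by rewrite big1 // => b /eqP ab; rewrite ab fsvalP in aB.
by rewrite (big_pred1 [` aB]%fset) // => b; rewrite eq_sym.
Qed.

Lemma sum_pcoef P (B : {fset index}) (F : index -> R) :
  \sum_(b : B) pcoef P (val b) * F (val b)
    = \sum_(t <- P) if t.2 \in B then t.1 * F t.2 else 0.
Proof.
rewrite /pcoef.
under eq_bigr do rewrite mulr_suml big_mkcond.
rewrite exchange_big /=; apply: eq_bigr => t _.
rewrite -big_mkcond /= -sum_fset_pred; apply: eq_bigr => b /eqP tb.
by rewrite tb.
Qed.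

Lemma sum_pcoef_peval P (B : {fset index}) h : {subset [seq t.2 | t <- P] <= B} ->
  \sum_(b : B) pcoef P (val b) * monomial (val b) h = peval P h.
Proof.
move=> sPB; rewrite (sum_pcoef P B (fun a => monomial a h)) /peval.
rewrite big_seq [RHS]big_seq; apply: eq_bigr => t tP.
by rewrite sPB // map_f.
Qed.

Lemma sum_norm_pcoef P (B : {fset index}) r : 0 <= r ->
  \sum_(b : B) `|pcoef P (val b)| * r ^+ deg (val b) <= pnorm r P.
Proof.
move=> r0.
pose P' : terms := [seq (`|t.1|, t.2) | t <- P].
apply: (@le_trans _ _ (\sum_(b : B) pcoef P' (val b) * r ^+ deg (val b))).
  apply: ler_sum => b _; rewrite ler_wpM2r ?exprn_ge0 //.
  by rewrite /pcoef big_map ler_norm_sum.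
rewrite (sum_pcoef P' B (fun a => r ^+ deg a)) big_map; apply: ler_sum => t _ /=.
by case: ifP => // _; rewrite mulr_ge0 ?exprn_ge0.
Qed.
End TermLists.

(** * Limits of polynomials as power series *)

Section Limits.
Context {R : realType} {n : nat}.
Local Notation index := {ffun 'I_n -> nat}.
Local Notation terms := (seq (R * index)).
Variables (S D : nat -> terms) (r C : R) (phi : 'rV[R]_n -> R).
Hypothesis r0 : 0 < r.
Hypothesis SD : forall k, S k.+1 = S k ++ D k.
Hypothesis normD : forall k, pnorm r (D k) <= C / 2 ^+ k.
Hypothesis cvg_peval : forall h : 'rV[R]_n, `|h| < r -> peval (S k) h @[k --> \oo] --> phi h.

Lemma sum_norm_pcoef_sub K j (B : {fset index}) :
  \sum_(b : B) `|pcoef (S (K + j)) (val b) - pcoef (S K) (val b)| * r ^+ deg (val b)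
    <= 2 * C / 2 ^+ K - 2 * C / 2 ^+ (K + j).
Proof.
elim: j => [|j IH].
  by rewrite addn0 subrr big1 // => b _; rewrite subrr normr0 mul0r.
rewrite addnS SD; have := le_trans (sum_norm_pcoef (D (K + j)) B (ltW r0)) (normD (K + j)).
move=> /(lerD IH); rewrite -big_split /=; move: (2 * C / 2 ^+ K) => c.
have -> : c - 2 * C / 2 ^+ (K + j) + C / 2 ^+ (K + j) = c - 2 * C / 2 ^+ (K + j).+1.
  by rewrite exprS; field; rewrite expf_neq0.
apply: le_trans; apply: ler_sum => b _.
rewrite pcoef_cat -mulrDl ler_wpM2r ?(exprn_ge0 _ (ltW r0)) //.
by rewrite addrAC ler_normD.
Qed.

Lemma C_ge0 : 0 <= C.
Proof. by have := le_trans (pnorm_ge0 (D 0%N) (ltW r0)) (normD 0); rewrite divr1. Qed.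

Lemma pcoefS k a : pcoef (S k) a = pcoef (S 0%N) a + series (fun j => pcoef (D j) a) k.
Proof.
elim: k => [|k IH]; first by rewrite seriesEnat /= big_geq // addr0.
by rewrite SD pcoef_cat IH -addrA seriesSr.
Qed.

Lemma cvg_half (c : R) : c / 2 ^+ k @[k --> \oo] --> (0 : R).
Proof.
have -> : (fun k => c / 2 ^+ k) = geometric c (2^-1 : R).
  by apply/funext => k; rewrite /geometric /= exprVn.
by apply: cvg_geometric; rewrite ger0_norm ?invr_ge0 // invf_lt1 ?ltr1n.
Qed.

Lemma is_cvg_pcoef a : cvgn (fun k => pcoef (S k) a).
Proof.
have ra : 0 < r ^+ deg a by rewrite exprn_gt0.
rewrite (funext (pcoefS^~ a)); apply: is_cvgD; first exact: is_cvg_cst.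
apply: normed_cvg; rewrite /normed_series_of.
apply: (@series_le_cvg _ _ (geometric (C / r ^+ deg a) (2^-1 : R))) => [k|k|k|].
- exact: normr_ge0.
- by rewrite /geometric /= mulr_ge0 ?exprn_ge0 ?invr_ge0 // divr_ge0 ?C_ge0 ?ltW.
- rewrite /geometric /= mulrAC ler_pdivlMr // exprVn.
  have := le_trans (sum_norm_pcoef (D k) [fset a]%fset (ltW r0)) (normD k).
  apply: le_trans; have aa : a \in [fset a]%fset by rewrite inE.
  rewrite (bigD1 [` aa]%fset) //= lerDl sumr_ge0 // => b _.
  by rewrite mulr_ge0 // exprn_ge0 // ltW.
- by apply: is_cvg_geometric_series; rewrite ger0_norm ?invr_ge0 // invf_lt1 ?ltr1n.
Qed.

Let c a : R := limn (fun k => pcoef (S k) a).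

Lemma sum_norm_lim_pcoef_sub K (B : {fset index}) :
  \sum_(b : B) `|c (val b) - pcoef (S K) (val b)| * r ^+ deg (val b) <= 2 * C / 2 ^+ K.
Proof.
have H : \sum_(b : B) `|pcoef (S k) (val b) - pcoef (S K) (val b)| * r ^+ deg (val b)
      @[k --> \oo] -->
    \sum_(b : B) `|c (val b) - pcoef (S K) (val b)| * r ^+ deg (val b).
  apply: cvg_big => [|b _]; first exact: add_continuous.
  apply: cvgMr_tmp; apply: cvg_norm; apply: cvgB; last exact: cvg_cst.
  exact: is_cvg_pcoef.
apply: (cvgr_to_le H).
exists K => // k /= Kk; rewrite -(subnKC Kk).
apply: le_trans (sum_norm_pcoef_sub K _ B) _.
by rewrite gerBl divr_ge0 ?mulr_ge0 ?C_ge0 ?exprn_ge0.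
Qed.

(** The coefficients [c] are the limits of those of [S k]. Summed with weights
    [r ^+ deg a] over any finite set of indices, they differ from those of
    [S K] by at most the tail [2 C / 2^K]; on a set that contains all indices
    of [S K] the coefficients of [S K] already add up to its value. *)
Lemma power_series_of_polynomials : exists c : index -> R, forall h : 'rV[R]_n, `|h| < r ->
  summability.partial_sum (fun a => c a * monomial a h)
    @ @summability.totally _ --> phi h.
Proof.
exists c => h hr; have TF := summability.totally_filter.
apply/cvgrPdist_le => e e0.
have e2 : 0 < e / 2 by rewrite divr_gt0.
have : \forall k \near \oo, `|phi h - peval (S k) h| <= e / 2 /\ 2 * C / 2 ^+ k <= e / 2.
  near=> k; split; near: k; first by have /cvgrPdist_le := cvg_peval hr; apply.
  have /cvgrPdist_le/(_ _ e2) := cvg_half (2 * C).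
  apply: filterS => k; rewrite sub0r normrN ger0_norm //.
  by rewrite divr_ge0 ?mulr_ge0 ?C_ge0 ?exprn_ge0.
move=> [K _ /(_ K (leqnn K))[phiK CK]].
exists [fset a in [seq t.2 | t <- S K]]%fset => // B /= /fsubsetP AB.
have sub : {subset [seq t.2 | t <- S K] <= B} by move=> a aS; apply: AB; rewrite inE.
rewrite -[X in `|X|](subrKA (peval (S K) h)) (splitr e).
apply: le_trans (ler_normD _ _) _; apply: lerD => //.
apply: le_trans CK; apply: le_trans (sum_norm_lim_pcoef_sub K B).
rewrite /summability.partial_sum -(sum_pcoef_peval h sub) -sumrB.
apply: le_trans (ler_norm_sum _ _ _) _; apply: ler_sum => b _.
rewrite -mulrBl normrM distrC ler_wpM2l //; apply: norm_monomial; exact: ltW.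
Unshelve. all: by end_near. Qed.
End Limits.

(** * Analyticity away from the origin *)

Section Expand.
Context {R : realType} {n : nat}.
Variable x : 'rV[R]_n.
Local Notation terms := (seq (R * {ffun 'I_n -> nat})).
Implicit Types (h : 'rV[R]_n).

Fixpoint inv_free (a : @rexpr R n) : bool :=
  match a with
  | RInvNorm => false
  | RAdd a b | RMul a b => inv_free a && inv_free b
  | _ => true
  end.

(** The Taylor list at [x] of an expression free of the inverse norm. *)
Fixpoint expand (a : @rexpr R n) : terms :=
  match a with
  | RCst c => pconst c
  | RLin u => pconst (dotv x u) ++ plin u
  | RInvNorm => [::]
  | RAdd a b => expand a ++ expand b
  | RMul a b => pmul (expand a) (expand b)
  end.

Lemma peval_expand a h : inv_free a -> peval (expand a) h = reval a (x + h).
Proof.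
elim: a => [c|u||a IHa b IHb|a IHa b IHb] // => [_|_|/andP[/IHa ea /IHb eb]|/andP[/IHa ea /IHb eb]].
- exact: peval_const.
- by rewrite [LHS]peval_cat peval_const peval_lin /= dotvDl.
- by rewrite [LHS]peval_cat ea eb.
- by rewrite [LHS]peval_mul ea eb.
Qed.

Lemma inv_free_rsum I (s : seq I) (F : I -> @rexpr R n) :
  (forall i, inv_free (F i)) -> inv_free (rsum [seq F i | i <- s]).
Proof. by move=> pF; elim: s => //= i s ->; rewrite pF. Qed.
End Expand.

Section Newton.
Context {R : realType} {n : nat}.
Variable x : 'rV[R]_n.
Hypothesis x0 : x != 0.
Local Notation terms := (seq (R * {ffun 'I_n -> nat})).
Implicit Types (h : 'rV[R]_n).

Let q := dotv x x.

Let e0 : terms := pmul (pconst (- q^-1))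
  (plin (2 *: x) ++ flatten [seq pmul (plin (delta_mx 0 i)) (plin (delta_mx 0 i)) | i <- index_enum 'I_n]).

Lemma q_gt0 : 0 < q.
Proof. by rewrite /q -sqr_rho exprn_gt0 // rho_gt0. Qed.

Lemma peval_flatten (I : Type) (s : seq I) (F : I -> terms) h :
  peval (flatten [seq F i | i <- s]) h = \sum_(i <- s) peval (F i) h.
Proof. by elim: s => [|i s IH] /=; rewrite ?big_nil /peval ?big_nil // big_cons big_cat -IH. Qed.

Lemma peval_e0 h : peval e0 h = 1 - dotv (x + h) (x + h) / q.
Proof.
rewrite peval_mul peval_const peval_cat peval_lin peval_flatten.
have -> : \sum_i peval (pmul (plin (delta_mx 0 i)) (plin (delta_mx 0 i))) h = dotv h h.
  rewrite [RHS]dotvE; apply: eq_bigr => i _; rewrite peval_mul !peval_lin.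
  by rewrite dotvC dotv_delta.
rewrite dotvDl !dotvDr dotvZr (dotvC x h) -/q; field.
by rewrite gt_eqF ?q_gt0.
Qed.

(** Newton's iteration [y := y (1 + e / 2)] for the inverse square root of
    [u = |x + h|^2 / |x|^2], together with the error [e = 1 - u y^2], which
    becomes [e^2 (3 + e) / 4]. Carrying [e] along as a list makes its norm
    visibly decrease, without cancellations between terms of [y]; and the new
    [y] extends the old list, so that increments are explicit. *)
Fixpoint newton (k : nat) : terms * terms :=
  if k is k.+1 then let: (y, e) := newton k in
    (y ++ pmul (pmul (pconst (1 / 2)) y) e,
     pmul (pconst (1 / 4)) (pmul (pmul e e) (pconst 3 ++ e)))
  else (pconst 1, e0).

Let Y k := (newton k).1.
Let Err k := (newton k).2.
Let Inc k := pmul (pmul (pconst (1 / 2)) (Y k)) (Err k).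

Lemma YS k : Y k.+1 = Y k ++ Inc k.
Proof. by rewrite /Y /Inc /Err /Y /=; case: (newton k). Qed.

Lemma ErrS k : Err k.+1 = pmul (pconst (1 / 4)) (pmul (pmul (Err k) (Err k)) (pconst 3 ++ Err k)).
Proof. by rewrite /Err /=; case: (newton k). Qed.

Lemma peval_YS k h : peval (Y k.+1) h = peval (Y k) h * (1 + peval (Err k) h / 2).
Proof. by rewrite YS peval_cat !peval_mul peval_const; field. Qed.

Lemma peval_Err k h :
  peval (Err k) h = 1 - dotv (x + h) (x + h) / q * peval (Y k) h ^+ 2.
Proof.
elim: k => [|k IH]; first by rewrite peval_e0 peval_const expr1n mulr1.
rewrite ErrS peval_YS !peval_mul peval_cat !peval_const.
move: IH; move: (peval (Y k) h) (peval (Err k) h) (_ / q) => y e u.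
by move=> ->; field.
Qed.

Lemma pnorm_flatten (I : Type) (s : seq I) (F : I -> terms) r :
  pnorm r (flatten [seq F i | i <- s]) = \sum_(i <- s) pnorm r (F i).
Proof. by elim: s => [|i s IH] /=; rewrite ?big_nil /pnorm ?big_nil // big_cons big_cat -IH. Qed.

Lemma exists_radius : exists2 r : R, 0 < r & pnorm r e0 <= 1 / 2.
Proof.
pose s := \sum_i `|(2 *: x) 0 i|.
pose t := \sum_i (\sum_j `|(delta_mx 0 i : 'rV[R]_n) 0 j|) ^+ 2.
pose a := `|- q^-1| * (s + t).
have st0 : 0 <= s + t.
  by rewrite addr_ge0 ?sumr_ge0 // => i _; rewrite ?sqr_ge0.
have a0 : 0 <= a by rewrite mulr_ge0.
pose r := 1 / (2 * (1 + a)).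
have a1 : 0 < 1 + a by rewrite ltr_wpDr.
have r0 : 0 < r by rewrite divr_gt0 // mulr_gt0.
have r1 : r <= 1.
  rewrite ler_pdivrMr ?mulr_gt0 //; move: a0; lra.
have ar : a * r <= 1 / 2.
  have -> : a * r = 1 / 2 - r by rewrite /r; field; rewrite gt_eqF.
  by rewrite gerBl ltW.
exists r => //; apply: le_trans ar.
rewrite pnorm_mul pnorm_const pnorm_cat pnorm_lin pnorm_flatten /a -mulrA ler_wpM2l //.
rewrite mulrDl lerD // /t mulr_suml; apply: ler_sum => i _.
rewrite pnorm_mul !pnorm_lin -expr2 exprMn ler_wpM2l ?sqr_ge0 //.
by rewrite expr2 ler_piMl // ltW.
Qed.

Variable r : R.
Hypothesis r0 : 0 < r.
Hypothesis pnorm_e0 : pnorm r e0 <= 1 / 2.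

Lemma pnorm_Err k : pnorm r (Err k) <= 1 / 2 / 2 ^+ k.
Proof.
elim: k => [|k IH]; first by rewrite divr1.
rewrite ErrS !pnorm_mul pnorm_cat !pnorm_const exprS.
have := pnorm_ge0 (Err k) (ltW r0); move: IH; move: (pnorm r (Err k)) => e.
have : (2 : R) ^- k <= 1 by rewrite invf_le1 ?exprn_gt0 // exprn_ege1 // ler1n.
rewrite (ger0_norm (_ : 0 <= 3 :> R)) // (ger0_norm (_ : 0 <= 1 / 4 :> R)) //.
rewrite invfM; move: (2 ^- k) => p p1 ep e0'.
have e1 : e <= 1 / 2 by move: p1 ep; lra.
have : e * e <= 1 / 2 * e by rewrite ler_wpM2r.
have : e * e * e <= 1 / 2 * (1 / 2 * e).
  by rewrite mulrA; apply: ler_pM => //; rewrite ?mulr_ge0 // ler_pM.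
move: ep e0'; lra.
Qed.

Lemma pnorm_Y k : pnorm r (Y k) <= 2 - 2 ^- k.
Proof.
elim: k => [|k IH]; first by rewrite pnorm_const normr1 expr0 invr1; lra.
rewrite YS pnorm_cat !pnorm_mul pnorm_const exprS invfM.
have := pnorm_Err k; have := pnorm_ge0 (Err k) (ltW r0).
have := pnorm_ge0 (Y k) (ltW r0); move: IH; move: (pnorm r (Y k)) (pnorm r (Err k)) => y e.
have : 0 < (2 : R) ^- k by rewrite invr_gt0 exprn_gt0.
rewrite (ger0_norm (_ : 0 <= 1 / 2 :> R)) //; move: (2 ^- k) => p p0 yp y0 e0' ep.
have : y * e <= 2 * (1 / 2 * p) by apply: ler_pM => //; move: yp p0; lra.
have : p * (2 - p) >= 0 -> y * e <= (2 - p) * (1 / 2 * p).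
  by move=> _; apply: ler_pM.
nra.
Qed.

Lemma pnorm_Inc k : pnorm r (Inc k) <= 1 / 2 ^+ k.
Proof.
rewrite /Inc !pnorm_mul pnorm_const (ger0_norm (_ : 0 <= 1 / 2 :> R)) //.
have := pnorm_Err k; have := pnorm_ge0 (Err k) (ltW r0).
have := pnorm_ge0 (Y k) (ltW r0); have := pnorm_Y k.
move: (pnorm r (Y k)) (pnorm r (Err k)) => y e.
have : 0 < (2 : R) ^- k by rewrite invr_gt0 exprn_gt0.
move: (2 ^- k) => p p0 yp y0 e0' ep.
have : y * e <= 2 * (1 / 2 * p) by apply: ler_pM => //; move: yp p0; lra.
move: p0; lra.
Qed.

Lemma peval_Y_gt0 k h : `|h| < r -> 0 < peval (Y k) h.
Proof.
move=> hr; elim: k => [|k IH]; first by rewrite peval_const.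
rewrite peval_YS mulr_gt0 //.
have : `|peval (Err k) h| <= 1 / 2.
  apply: le_trans (norm_peval _ (ltW hr)) _; apply: le_trans (pnorm_Err k) _.
  by rewrite ler_pdivrMr ?exprn_gt0 // ler_peMr // exprn_ege1 // ler1n.
by rewrite ler_norml => /andP[]; lra.
Qed.

(** As [y >= 0], [|y sqrt u - 1| <= |(y sqrt u)^2 - 1|], which is the error
    [|e|]. *)
Lemma cvg_newton h : `|h| < r -> peval (Y k) h @[k --> \oo] --> rho x / rho (x + h).
Proof.
move=> hr; pose u := dotv (x + h) (x + h) / q.
have u0 : 0 < u.
  have := norm_peval e0 (ltW hr); rewrite peval_e0 -/u => /le_trans/(_ pnorm_e0).
  by rewrite ler_norml => /andP[_]; lra.
have -> : rho x / rho (x + h) = (Num.sqrt u)^-1.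
  by rewrite /u /rho sqrtrM ?dotv_ge0 // sqrtrV ?dotv_ge0 // invfM invrK mulrC.
have su : 0 < Num.sqrt u by rewrite sqrtr_gt0.
apply/cvgrPdist_le => e e_gt0.
have := cvg_half (1 / 2 / Num.sqrt u) => /cvgrPdist_le/(_ e e_gt0).
apply: filterS => k; rewrite sub0r normrN ger0_norm; last first.
  by rewrite divr_ge0 ?exprn_ge0 // divr_ge0 // ltW.
apply: le_trans; rewrite mulrAC ler_pdivlMr //.
have := le_trans (norm_peval (Err k) (ltW hr)) (pnorm_Err k).
apply: le_trans; rewrite peval_Err -/u -{2}[Num.sqrt u](ger0_norm (ltW su)) -normrM.
have := peval_Y_gt0 k hr; move: (peval _ h) => y y0.
move: (sqr_sqrtr (ltW u0)); move: (Num.sqrt u) su => s s0 <-.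
rewrite mulrBl mulVf ?gt_eqF //.
have -> : 1 - s ^+ 2 * y ^+ 2 = (1 - y * s) * (1 + y * s) by ring.
rewrite normrM ler_peMr // ger0_norm ?lerDl; last by rewrite addr_ge0 // mulr_ge0 // ltW.
by rewrite mulr_ge0 // ltW.
Qed.
End Newton.

Section Analytic.
Context {R : realType} {n : nat}.

Lemma analytic_inv_free (a : @rexpr R n) : inv_free a ->
  real_analytic_on (~` [set 0]) (reval (RMul a RInvNorm)).
Proof.
move=> pa x /eqP x0; have [r r0 rE] := exists_radius x.
pose f := pmul (pconst (rho x)^-1) (expand x a).
pose S k := pmul (newton x k).1 f.
pose D k := pmul (pmul (pmul (pconst (1 / 2)) (newton x k).1) (newton x k).2) f.
have [||h hr|c cP] := @power_series_of_polynomials R n S D r (pnorm r f)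
  (fun h => reval (RMul a RInvNorm) (x + h)) r0.
- by move=> k; rewrite /S YS pmul_cat.
- move=> k; rewrite pnorm_mul mulrC ler_wpM2l ?(pnorm_ge0 _ (ltW r0)) //.
  have := pnorm_Inc r0 rE k; rewrite [leRHS]mul1r; apply.
- have -> : (fun k => peval (S k) h)
      = (fun k => peval (newton x k).1 h * (reval a (x + h) / rho x)).
    by apply/funext => k; rewrite !peval_mul peval_const peval_expand // [_^-1 * _]mulrC.
  have -> : reval (RMul a RInvNorm) (x + h)
      = rho x / rho (x + h) * (reval a (x + h) / rho x).
    by rewrite /=; move: (rho (x + h))^-1 => s; field; exact: rho_neq0.
  apply: cvgMr_tmp; exact: (cvg_newton x0 r0 rE hr).
by exists c, r.
Qed.
End Analytic.

(** * Solvability and regularity together *)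

Theorem theorem1p1 (R : realType) (m : nat) (E : 'I_(dimSym0 m) -> 'M[R]_m) :
  (3 <= m)%N -> orthonormal_basis_Sym0 E ->
  (exists F : 'M[R]_(dimSym0 m) -> R,
     uniformly_elliptic 1 (1 + (m%:R + 3) * ((dimSym0 m)%:R + 3)) F /\
     viscosity_solution F setT (w E)) /\
  [/\ C11 (w E),
      positively_homogeneous 2 (w E),
      real_analytic_on (~` [set 0]) (w E) &
      ~ twice_differentiable_at 0 (w E)].
Proof.
move=> m3 onE; split; first exact: exists_elliptic_operator.
split; [exact: C11_w|exact: homogeneous_w| |exact: not_twice_differentiable_w].
by rewrite (w_reval onE); apply: analytic_inv_free; exact: inv_free_rsum.
Qed.
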